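(* Any stratum $\mathcal{Q}_1(k_1,\ldots,k_r)$ of (area-one) quadratic differentials with at most simple poles on $\mathbb{CP}^1$ has only one topological end.
   Context: A meromorphic quadratic differential $q$ with at most simple poles on $\mathbb{CP}^1$ defines a flat metric for which a singularity of order $k\ge-1$ is a cone point of angle $(k+2)\pi$. The stratum $\mathcal{Q}(k_1,\ldots,k_r)$ is the moduli space of such $(\mathbb{CP}^1,q)$ with $q$ not globally the square of an Abelian differential and with $\{k_1,\ldots,k_r\}$ as multiset of orders of singularities (so $\sum_i k_i=-4$); $\mathcal{Q}_1(k_1,\ldots,k_r)$ is the subset of surfaces of flat area $1$. An end of a space $W$ is a function $\epsilon$ from the compact subsets of $W$ to the subsets of $W$ such that $\epsilon(K)$ is an unbounded (i.e. not relatively compact) connected component of $W\setminus K$ for each compact $K$, and $\epsilon(L)\subset\epsilon(K)$ whenever $K\subset L$. *)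

(* Defs.v *)
From HB Require Import structures.
From mathcomp Require Import all_boot all_order all_algebra all_fingroup.
From mathcomp Require Import all_classical all_reals all_analysis.
From mathcomp Require Import complex.
Set Implicit Arguments.
Unset Strict Implicit.
Unset Printing Implicit Defensive.
Import Order.TTheory GRing.Theory Num.Theory.
Import numFieldNormedType.Exports.
Local Open Scope classical_set_scope.
Local Open Scope ring_scope.
Local Open Scope quotient_scope.

(* The usual topology of the complex plane *)
HB.instance Definition _ (R : realType) := NormedModule.copy R[i] R[i]^o.

Section Ends.
Variable W : topologicalType.

Definition is_component (A C : set W) : Prop :=
  exists2 x, A x & C = connected_component A x.

Definition is_end (e : {K : set W | compact K} -> set W) : Prop :=
  (forall K, is_component (~` sval K) (e K) /\ ~ precompact (e K)) /\
  (forall K L, sval K `<=` sval L -> e L `<=` e K).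

End Ends.

(* Points of CP^1 are written in homogeneous coordinates v = (X, Y), and
   z = X / Y is the affine coordinate.  Since XdY - YdX is homogeneous of
   degree 2 and equals -dz where Y = 1, a meromorphic quadratic differential on
   CP^1 is F(X, Y) (XdY - YdX)^2 for a rational F homogeneous of degree -4; on
   the chart Y = 1 it reads F(z, 1) dz^2.  If its divisor is the sum of the
   k_i [p_i], with k_0 + ... + k_(r-1) = -4, then
     F(v) = c * \prod_i (wedge v p_i) ^ k_i   for some c != 0.
   All points of CP^1, infinity included, are treated alike.  The indices i
   with k_i = 0 are marked points. *)
Section Stratum.
Variables (R : realType) (r : nat) (k : 'I_r -> int).
Local Notation C := R[i].

Definition wedge (v w : 'rV[C]_2) : C :=
  v ord0 ord0 * w ord0 ord_max - v ord0 ord_max * w ord0 ord0.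

(* A pair of the constant c and the matrix whose i-th row holds homogeneous
   coordinates of the i-th singularity. *)
Local Notation qdata := (C * 'M[C]_(r, 2))%type.

Implicit Types a b d : qdata.

Definition sing a (i : 'I_r) : 'rV[C]_2 := row i a.2.

(* At a pole the value is 0, because 0^-1 = 0 *)
Definition qcoef a (v : 'rV[C]_2) : C :=
  a.1 * \prod_(i < r) wedge v (sing a i) ^ k i.

Definition affine (z : C) : 'rV[C]_2 :=
  \row_(j < 2) if j == ord0 then z else 1.

(* The meromorphic Abelian differentials on CP^1 are the (f / g) dz with f and
   g polynomials; one whose square has at most simple poles is holomorphic. *)
Definition is_square a : Prop :=
  exists f g : {poly C}, g != 0 /\
    forall z, g.[z] != 0 -> qcoef a (affine z) = (f.[z] / g.[z]) ^+ 2.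

Definition is_qdiff : set qdata := [set a |
  [/\ a.1 != 0,
      forall i, sing a i != 0,
      forall i j, i != j -> wedge (sing a i) (sing a j) != 0 &
      ~ is_square a]].

(* The Moebius map [v] |-> [v *m g] carries singularities to singularities of
   the same order and pulls back the second differential to the first one: it
   multiplies XdY - YdX by \det g. *)
Definition isomorphic a b : Prop :=
  exists (g : 'M[C]_2) (s : 'S_r),
    [/\ g \in unitmx,
        forall i, k (s i) = k i,
        forall i, exists2 l : C, l != 0 & sing b (s i) = l *: (sing a i *m g) &
        forall v, qcoef b (v *m g) * \det g ^+ 2 = qcoef a v].

Lemma isomorphic_refl a : isomorphic a a.
Proof.
exists 1%:M, 1%g; split=> [|i|i|v]; first exact: unitmx1.
- by rewrite perm1.
- by exists 1; rewrite ?oner_eq0// perm1 mulmx1 scale1r.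
- by rewrite mulmx1 det1 expr1n mulr1.
Qed.

Lemma isomorphic_sym a b : isomorphic a b -> isomorphic b a.
Proof.
move=> [g [s [gu ks sg qg]]]; exists (invmx g), s^-1%g.
split=> [|i|i|v]; first by rewrite unitmx_inv.
- by rewrite -[in RHS](permKV s i) ks.
- have [l l0 sl] := sg (s^-1%g i); exists l^-1; first by rewrite invr_eq0.
  by rewrite permKV in sl; rewrite sl -scalemxAl mulmxK// scalerA mulVf// scale1r.
- have := qg (v *m invmx g); rewrite mulmxKV// => <-.
  rewrite det_inv exprVn mulfK// expf_eq0 /=.
  by rewrite unitmxE unitfE in gu.
Qed.

Lemma isomorphic_trans a b d :
  isomorphic a b -> isomorphic b d -> isomorphic a d.
Proof.
move=> [g [s [gu ks sg qg]]] [h [t [hu kt th qh]]].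
exists (g *m h), (s * t)%g; split=> [|i|i|v]; first by rewrite unitmx_mul gu.
- by rewrite permM kt ks.
- have [l l0 sl] := sg i; have [m m0 tm] := th (s i).
  exists (m * l); first by rewrite mulf_neq0.
  by rewrite permM tm sl -scalemxAl scalerA mulmxA.
- by rewrite -qg -qh det_mulmx exprMn mulmxA -mulrA [_ ^+ 2 * _]mulrC.
Qed.

Local Notation qdiff := (set_type is_qdiff).

Definition isom_rel (a b : qdiff) : bool := `[< isomorphic (val a) (val b) >].

Lemma isom_rel_equiv : equiv_class_of isom_rel.
Proof.
split=> [a|a b|b a d].
- exact/asboolP/isomorphic_refl.
- by apply/asboolP/asboolP; exact: isomorphic_sym.
- by move=> /asboolP ab /asboolP bd; exact/asboolP/(isomorphic_trans ab bd).
Qed.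

Canonical isom_equiv : equiv_rel qdiff := EquivRelPack isom_rel_equiv.

Definition stratum : topologicalType :=
  quotient_topology {eq_quot isom_equiv}.

(* Area of the metric |F(z, 1)| |dz|^2 *)
Definition flat_area a : \bar R :=
  (\int[(@lebesgue_measure R \x @lebesgue_measure R)%E]_(u in setT)
     (Normc.normc (qcoef a (affine (Complex u.1 u.2))))%:E)%E.

Definition area_one : set stratum :=
  [set \pi_stratum a | a in [set a : qdiff | flat_area (val a) = 1%:E]].

Definition stratum1 : topologicalType := set_type area_one.

End Stratum.

(* Main.v *)
From HB Require Import structures.
Require Import Defs.
From mathcomp Require Import all_boot all_order all_algebra all_fingroup.
From mathcomp Require Import all_classical all_reals all_analysis.
From mathcomp Require Import measurable_realfun complex.
From mathcomp Require Import ring lra zify.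

(** A point of the stratum is a finite configuration of singularities on the
    sphere, up to Moebius maps and relabelling, with a constant factor. The
    area of a differential is positive, finite and continuous in the
    configuration ([flat_area_regular]), and invariant under isomorphism
    ([flat_area_isomorphic]). So every datum with nonzero constant and distinct
    singularities can be rescaled to area one by a positive real, and the
    stratum of area one is a continuous image of the open set [regular] of such
    data ([proj], [continuous_proj], [proj_surj]). That none of these data is a
    square comes from the simple poles ([not_square]).

    The distance to infinity is measured by the moduli of the cross-ratios of
    four singularities. They do not depend on the constant and are merely
    permuted by isomorphisms.
    - If they are all at most [N], then three singularities may be put at
      infinity, 0 and 1, and the constant on the unit circle; the other
      singularities are then bounded and the distances between singularities
      are bounded from below. Such data form a compact set ([compact_thick],
      [thick_cover]): the part of the stratum where some cross-ratio exceeds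
      [N] has a relatively compact complement.
    - This part is connected ([connected_above]). Where the cross-ratio of four
      given singularities exceeds [N], normal forms turn the condition into a
      punctured disc for one coordinate, and two points are joined by a generic
      arc in the complex line through them, which meets the finitely many
      excluded hyperplanes nowhere ([connected_slab]). These pieces are indexed
      by two disjoint pairs of singularities, one of which has to be close, and
      meet when they share a pair. For at least five singularities, the graph of
      disjoint pairs is connected; for four, all singularities are simple poles
      and all pieces coincide by relabelling.
    A space exhausted in this way has exactly one end ([unique_end]).

    For the area, Moebius maps are decomposed into affine maps and the inversion,
    and the change of variables for the inversion reduces, in the coordinates
    x and y / x, to the one for the reciprocal on the line
    ([ge0_integral_inversion], [cint_moebius]). Finiteness and continuity come
    from a bound of the density by translates of one integrable kernel,
    uniformly near each configuration ([prod_nrm_bound], [cvg_points_area]). *)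

Set Implicit Arguments.
Unset Strict Implicit.
Unset Printing Implicit Defensive.
Import Order.TTheory GRing.Theory Num.Theory.
Import numFieldNormedType.Exports.

(** * Pushing forward a measure with a density *)

Section change_of_variables.
Local Open Scope classical_set_scope.
Local Open Scope ring_scope.
Local Open Scope ereal_scope.
Context d1 d2 (X : measurableType d1) (Y : measurableType d2) (R : realType).
Variables (mu : {measure set X -> \bar R}) (nu : {measure set Y -> \bar R}).
Variables (phi : X -> Y) (w : X -> R).
Hypotheses (mphi : measurable_fun setT phi) (mw : measurable_fun setT w).
Hypothesis w0 : forall x, (0 <= w x)%R.

Let w_indic (A : set Y) : measurable A ->
  measurable_fun setT (fun x => (\1_A (phi x) * w x)%:E).
Proof.
move=> mA; apply/measurable_EFinP/measurable_funM => //.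
by apply: measurableT_comp => //; exact: measurable_indic.
Qed.

Definition wpushforward (A : set Y) := \int[mu]_x (\1_A (phi x) * w x)%:E.

Let wpushforward0 : wpushforward set0 = 0.
Proof. by rewrite /wpushforward integral0_eq// => x _; rewrite indic0 mul0r. Qed.

Let wpushforward_ge0 A : 0 <= wpushforward A.
Proof. by apply: integral_ge0 => x _; rewrite lee_fin mulr_ge0. Qed.

Let wpushforward_sigma_additive : semi_sigma_additive wpushforward.
Proof.
move=> F mF tF mUF; rewrite /wpushforward.
rewrite (_ : (\int[mu]_x _) = \sum_(n <oo) \int[mu]_x (\1_(F n) (phi x) * w x)%:E).
  by apply: is_cvg_ereal_nneg_natsum_cond => n _ _; exact: wpushforward_ge0.
rewrite -integral_nneseries//; last 2 first.
- by move=> n; apply: w_indic.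
- by move=> n x _; rewrite lee_fin mulr_ge0.
apply: eq_integral => x _.
under eq_eseriesr do rewrite mulrC EFinM.
rewrite mulrC EFinM nneseriesZl//.
congr (_ * _).
have := @measure_semi_bigcup _ _ _ (dirac (phi x) : {measure set Y -> \bar R}) F mF tF mUF.
exact.
Qed.

Definition wpushforward_measure : {measure set Y -> \bar R} :=
  HB.pack wpushforward (isMeasure.Build _ _ _ wpushforward
    wpushforward0 wpushforward_ge0 wpushforward_sigma_additive).

Hypothesis nuE : forall A, measurable A -> wpushforward A = nu A.

Import HBNNSimple.

(** Nonnegative functions are increasing limits of simple ones, so the identity
    of measures [nuE] is all that a change of variables asks for. *)
Lemma ge0_integral_wpushforward (f : Y -> \bar R) :
  measurable_fun setT f -> (forall y, 0 <= f y) ->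
  \int[mu]_x (f (phi x) * (w x)%:E) = \int[nu]_y f y.
Proof.
move=> mf f0.
pose f_ := nnsfun_approx measurableT mf.
have cvgf y : EFin \o f_ ^~ y @ \oo --> f y by apply: cvg_nnsfun_approx => // ? _.
transitivity (limn (fun n => \int[mu]_x ((f_ n (phi x))%:E * (w x)%:E))).
  rewrite -monotone_convergence//; first last.
  - move=> x _ m n mn; apply: lee_wpmul2r; rewrite ?lee_fin//.
    exact/lefP/nd_nnsfun_approx.
  - by move=> n x _; apply: mule_ge0; rewrite lee_fin.
  - move=> n; under eq_fun do rewrite -EFinM.
    apply/measurable_EFinP/measurable_funM => //.
    by apply: measurableT_comp.
  apply: eq_integral => x _; apply/esym/cvg_lim => //.
  by apply: cvgeZr => //; exact: cvgf.
transitivity (limn (fun n => \int[nu]_y (f_ n y)%:E)); last first.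
  rewrite -monotone_convergence//.
  - by apply: eq_integral => y _; apply/cvg_lim => //; exact: cvgf.
  - by move=> n; apply/measurable_EFinP.
  - by move=> n y _; rewrite lee_fin.
  - by move=> y _ m n mn; rewrite lee_fin; exact/lefP/nd_nnsfun_approx.
congr (limn _); apply/funext => n.
transitivity (\sum_(k \in range (f_ n)) (k%:E * nu (f_ n @^-1` [set k]))).
  transitivity (\int[mu]_x (\sum_(k \in range (f_ n))
     (k%:E * (\1_(f_ n @^-1` [set k]) (phi x) * w x)%:E))).
    apply: eq_integral => x _; rewrite fimfunE -fsumEFin// ge0_mule_fsuml.
      by apply: eq_fsbigr => k _; rewrite -!EFinM mulrA.
    by move=> k; exact: nnfun_muleindic_ge0.
  rewrite ge0_integral_fsum//.
  - apply: eq_fsbigr => k kr; rewrite ge0_integralZl//.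
    + by rewrite -nuE.
    + exact: w_indic.
    + by move=> x _; rewrite lee_fin mulr_ge0.
    + by move: kr; rewrite inE => -[y _ <-]; rewrite lee_fin.
  - move=> k; apply: emeasurable_funM => //; exact: w_indic.
  - move=> k x _; rewrite -EFinM lee_fin.
    rewrite mulrA mulr_ge0// -lee_fin EFinM; exact: nnfun_muleindic_ge0.
under eq_integral do rewrite fimfunE -fsumEFin//.
rewrite ge0_integral_fsum//.
- apply: eq_fsbigr => k _; under eq_integral do rewrite EFinM.
  by rewrite integralZl_indic_nnsfun// integral_indic// setIT.
- by move=> k; apply/measurable_EFinP/measurable_funM.
- by move=> k x _; rewrite nnfun_muleindic_ge0.
Qed.
End change_of_variables.

(** * Affine maps and the reciprocal on the line *)

Section one_variable.
Local Open Scope classical_set_scope.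
Local Open Scope ring_scope.
Context {R : realType}.
Local Notation mu := (@lebesgue_measure R).
Local Notation T := (measurableTypeR R).

Lemma measurable_inv : measurable_fun [set: T] (fun x : R => x^-1 : T).
Proof.
rewrite (_ : (fun _ => _) = (fun x : R => x * (`|x| `^ (-2)))).
  apply: measurable_funM => //.
  by apply: (measurableT_comp (measurable_powR _)); exact: normr_measurable.
apply/funext => x; rewrite -[-2]/((- 2%:Z)%:~R) powR_intmul// -exprnN real_normK ?num_real//.
have [->|x0] := eqVneq x 0; first by rewrite invr0 mul0r.
by rewrite -exprVn expr2 mulrA divff// mul1r.
Qed.

(** By uniqueness of the Lebesgue measure, half-open intervals suffice. *)
Lemma ge0_integral_affine (a b : R) (f : R -> \bar R) : a != 0 ->
  measurable_fun [set: R] f -> (forall x, (0 <= f x)%E) ->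
  (\int[mu]_x (f (a * x + b)%R * `|a|%:E) = \int[mu]_x f x)%E.
Proof.
move=> a0 mf f0.
have maff : measurable_fun [set: T] (fun x : R => a * x + b : T).
  by apply: measurable_funD => //; exact: measurable_funM.
have mcst : measurable_fun [set: T] (fun=> `|a|) by [].
have c0 (x : T) : 0 <= `|a| by [].
suff H X : ocitv X -> mu X = wpushforward_measure mu maff mcst c0 X.
  apply: (ge0_integral_wpushforward maff mcst c0) => // A mA; apply/esym.
  exact: (lebesgue_measure_unique H mA).
move=> [[p q] _ <-].
rewrite /= /wpushforward.
under eq_integral do rewrite EFinM muleC.
rewrite ge0_integralZl//; last first.
  apply/measurable_EFinP; by apply: measurableT_comp => //; exact: measurable_indic.
have -> : (\int[mu]_x (\1_`]p, q] (a * x + b)%R)%:E)%E =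
   mu ((fun x : R => a * x + b) @^-1` `]p, q]).
  rewrite -(setIT (_ @^-1` _)) -integral_indic//.
  by rewrite -[X in measurable X]setTI; exact: maff.
have [ap|an|/eqP] := ltgtP 0 a; last by rewrite eq_sym (negbTE a0).
- rewrite (_ : _ @^-1` _ = `](p - b) / a, (q - b) / a]%classic); last first.
    apply/seteqP; split => x /=; rewrite !in_itv/= ltr_pdivrMr// ler_pdivlMr//;
    rewrite ltrBlDr lerBrDr mulrC//.
  rewrite !lebesgue_measure_itv/= !lte_fin ltr_pM2r ?invr_gt0// ltrD2r.
  case: ifPn => pq; last by rewrite mule0.
  rewrite gtr0_norm// -!EFinM -!EFinD; congr EFin; field; exact: lt0r_neq0.
- rewrite (_ : _ @^-1` _ = `[(q - b) / a, (p - b) / a[%classic); last first.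
    apply/seteqP; split => x /=; rewrite !in_itv/= ler_ndivrMr// ltr_ndivlMr//;
    rewrite ltrBlDr lerBrDr mulrC andbC//.
  rewrite !lebesgue_measure_itv/= !lte_fin ltr_nM2r ?invr_lt0// ltrD2r.
  case: ifPn => pq; last by rewrite mule0.
  rewrite ltr0_norm// -!EFinM -!EFinD; congr EFin; field; exact: ltr0_neq0.
Qed.

Section even_measure.
Variable nu : {measure set T -> \bar R}.
Hypothesis nu_oc0 : forall b : R, 0 <= b -> nu `]0, b]%classic = b%:E.
Hypothesis nu_set1 : forall c : R, nu [set c] = 0%E.
Hypothesis nuN : forall A : set R, measurable A -> nu (-%R @^-1` A) = nu A.

Let nuU (A B : set T) : measurable A -> measurable B -> A `&` B = set0 ->
  nu (A `|` B) = (nu A + nu B)%E.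
Proof. exact: measureU. Qed.

Let nu_oc_pos (a b : R) : 0 <= a -> a <= b -> nu `]a, b]%classic = (b - a)%:E.
Proof.
move=> a0 ab; have := nu_oc0 (le_trans a0 ab).
have -> : `]0, b]%classic = `]0, a] `|` `]a, b] by rewrite (@itv_bndbnd_setU _ _ (BRight 0) (BRight a)) ?bnd_simp.
rewrite nuU//; last first.
  rewrite -subset0 => x [/=]; rewrite !in_itv/= => /andP[_ xa] /andP[ax _].
  by have := lt_le_trans ax xa; rewrite ltxx.
rewrite nu_oc0//.
by case: (nu `]a, b]%classic) => [r||]//= [<-]; rewrite [a + r]addrC addrK.
Qed.

Let nu_co_pos (a b : R) : 0 <= a -> a <= b -> nu `[a, b[%classic = (b - a)%:E.
Proof.
move=> a0; rewrite le_eqVlt => /predU1P[->|ab].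
  by rewrite set_itvxx measure0 subrr.
have := nu_oc_pos a0 (ltW ab).
have -> : `[a, b[%classic = a |` `]a, b[ by rewrite setU1itv ?bnd_simp.
have -> : `]a, b]%classic = `]a, b[ `|` [set b] by rewrite setUitv1 ?bnd_simp.
rewrite !nuU ?nu_set1 ?add0e ?adde0//.
- by rewrite -subset0 => x [/= ->]; rewrite in_itv/= ltxx.
- by rewrite -subset0 => x [/=] /[swap] ->; rewrite in_itv/= ltxx andbF.
Qed.

(** For the reciprocal, only the image measure of the intervals ]0, b] is directly
    an integral; evenness and additivity determine it on all the others. *)
Lemma lebesgue_measure_even_unique X : ocitv X -> mu X = nu X.
Proof.
move=> [[a b] _ <-]; rewrite lebesgue_measure_itv/= lte_fin.
have [ab|ba] := ltP a b; last by rewrite set_itv_ge ?measure0 ?bnd_simp -?leNgt.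
rewrite -EFinD; have [a0|a0] := leP 0 a; first by rewrite nu_oc_pos// ltW.
have nu_neg c : c <= 0 -> a <= c -> nu `]a, c]%classic = (c - a)%:E.
  move=> c0 ac; rewrite -nuN// opp_preimage_itvbndbnd/= nu_co_pos ?oppr_ge0 ?lerN2//.
  by rewrite opprK addrC.
have [b0|b0] := leP b 0; first by rewrite nu_neg// ltW.
have -> : `]a, b]%classic = `]a, 0] `|` `]0, b].
  by rewrite (@itv_bndbnd_setU _ _ (BRight a) (BRight 0)) ?bnd_simp ?ltW.
rewrite nuU//; last first.
  rewrite -subset0 => x [/=]; rewrite !in_itv/= => /andP[_ x0] /andP[x0' _].
  by have := lt_le_trans x0' x0; rewrite ltxx.
by rewrite nu_neg ?(ltW a0)// nu_oc0 ?(ltW b0)// -EFinD sub0r addrC.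
Qed.

End even_measure.

Let w (x : R) : R := x^-1 ^+ 2.
Let mw : measurable_fun [set: T] w.
Proof. by apply: measurable_funX; exact: measurable_inv. Qed.
Let w0 (x : T) : 0 <= w x. Proof. exact: sqr_ge0. Qed.
Let nu := wpushforward_measure mu measurable_inv mw w0.

Let nu_oc0 (b : R) : 0 <= b -> nu `]0, b]%classic = b%:E.
Proof.
rewrite le_eqVlt => /predU1P[<-|b0]; first by rewrite set_itvxx measure0.
rewrite /nu/= /wpushforward.
transitivity (\int[mu]_(x in `[(b^-1)%R, +oo[) (w x)%:E)%E.
  rewrite [RHS]integral_mkcond; apply: eq_integral => x _.
  rewrite /patch indicE !mem_setE !in_itv/= andbT.
  have [x0|x0] := ltP 0 x^-1.
    rewrite invr_gt0 in x0.
    rewrite /= -[x^-1 <= b]lef_pV2 ?invrK ?posrE ?invr_gt0//.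
    by case: ifPn => /= _; rewrite ?mul1r ?mul0r.
  rewrite /= mul0r ifF//; apply/negbTE; rewrite -ltNge.
  by rewrite invr_le0 in x0; rewrite (le_lt_trans x0)// invr_gt0.
rewrite (@ge0_continuous_FTC2y _ _ (fun x => - x^-1) _ 0).
- by rewrite invrK -EFinN opprK -EFinD add0r.
- by move=> x _; exact: w0.
- apply: continuous_in_subspaceT => x; rewrite inE/= in_itv/= andbT => bx.
  have x0 : x != 0 by rewrite gt_eqF// (lt_le_trans _ bx)// invr_gt0.
  exact: (continuous_comp (inv_continuous x0) (@exprn_continuous _ 2 _)).
- rewrite -oppr0; apply: cvgN; apply/gtr0_cvgV0; [exact: nbhs_pinfty_gt|exact: cvg_id].
- move=> x bx; apply: derivableN; apply: derivableV => //.
  by rewrite gt_eqF// (lt_trans _ bx)// invr_gt0.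
- apply: cvgN; apply: cvg_at_right_filter; apply: inv_continuous.
  by rewrite invr_eq0 gt_eqF.
- move=> x; rewrite in_itv/= andbT => bx.
  have x0 : x != 0 by rewrite gt_eqF// (lt_trans _ bx)// invr_gt0.
  rewrite derive1E deriveN//; last exact: derivableV.
  by rewrite deriveV// derive_id /w -exprVn scaleNr opprK /GRing.scale/= mulr1.
Qed.

Let nu_set1 (c : R) : nu [set c] = 0%E.
Proof.
rewrite /nu/= /wpushforward.
transitivity (\int[mu]_(x in [set (c^-1)%R]) (w x)%:E)%E; last first.
  by rewrite integral_set1.
rewrite [RHS]integral_mkcond; apply: eq_integral => x _.
rewrite /patch indicE !in_set1 -[x == _](can_eq (@invrK R)) invrK.
by case: ifPn => _; rewrite ?mul1r ?mul0r.
Qed.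

Let nuN (A : set R) : measurable A -> nu (-%R @^-1` A) = nu A.
Proof.
move=> mA; rewrite /nu/= /wpushforward.
rewrite -[RHS](@ge0_integral_affine (-1) 0) ?oppr_eq0 ?oner_eq0//.
- apply: eq_integral => x _.
  rewrite addr0 mulN1r normrN1 mule1 invrN; congr (_ * _)%:E.
  by rewrite /w invrN sqrrN.
- apply/measurable_EFinP; apply: measurable_funM => //.
  by apply: measurableT_comp; [exact: measurable_indic|exact: measurable_inv].
- by move=> x; rewrite lee_fin mulr_ge0.
Qed.

(** The image measure of ]0, b] is the integral of 1 / x ^ 2 over [1 / b, +oo[,
    that is b by the fundamental theorem of calculus. *)
Lemma ge0_integral_recip (f : R -> \bar R) :
  measurable_fun [set: R] f -> (forall x, (0 <= f x)%E) ->
  (\int[mu]_x (f x^-1%R * (x^-1 ^+ 2)%:E) = \int[mu]_x f x)%E.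
Proof.
move=> mf f0.
suff H X : ocitv X -> mu X = nu X.
  apply: (ge0_integral_wpushforward measurable_inv mw w0) => // A mA; apply/esym.
  exact: (lebesgue_measure_unique H mA).
by move=> oX; apply: (lebesgue_measure_even_unique nu_oc0 nu_set1 nuN).
Qed.

End one_variable.

(** * Affine maps and the inversion on the plane *)

Section two_variables.
Local Open Scope classical_set_scope.
Local Open Scope ring_scope.
Context {R : realType}.
Local Notation mu := (@lebesgue_measure R).
Local Notation T := (measurableTypeR R).
Local Notation mu2 := ((@lebesgue_measure R \x @lebesgue_measure R)%E).
Implicit Types F G : T * T -> \bar R.

(** Slopes and inverses behave badly on the fibre x = 0 only, which Tonelli's
    theorem allows to ignore. *)
Lemma eq_ge0_integral_fibre2 F G :
  measurable_fun setT F -> (forall u, (0 <= F u)%E) ->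
  measurable_fun setT G -> (forall u, (0 <= G u)%E) ->
  (forall x : R, x != 0 -> (\int[mu]_y F (x, y) = \int[mu]_y G (x, y))%E) ->
  (\int[mu2]_u F u = \int[mu2]_u G u)%E.
Proof.
move=> mF F0 mG G0 FG; rewrite (fubini_tonelli1 _ mF F0) (fubini_tonelli1 _ mG G0).
apply: ae_eq_integral => //; [exact: measurable_fun_fubini_tonelli_F|
  exact: measurable_fun_fubini_tonelli_F|].
exists [set 0]; split=> //; first exact: lebesgue_measure_set1.
move=> x /= /not_implyP[_] nFG; apply: contrapT => /eqP x0; apply: nFG.
exact: FG.
Qed.

Lemma eq_ge0_integral_fibre1 F G :
  measurable_fun setT F -> (forall u, (0 <= F u)%E) ->
  measurable_fun setT G -> (forall u, (0 <= G u)%E) ->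
  (forall y : R, (\int[mu]_x F (x, y) = \int[mu]_x G (x, y))%E) ->
  (\int[mu2]_u F u = \int[mu2]_u G u)%E.
Proof.
move=> mF F0 mG G0 FG; rewrite (fubini_tonelli1 _ mF F0) (fubini_tonelli1 _ mG G0).
rewrite (fubini_tonelli _ mF F0) (fubini_tonelli _ mG G0).
by apply: eq_integral => y _; exact: FG.
Qed.

Lemma ge0_integral_affine1 (a : R) (b : R -> R) G : a != 0 ->
  measurable_fun [set: T] (b : T -> T) ->
  measurable_fun setT G -> (forall u, (0 <= G u)%E) ->
  (\int[mu2]_u (G (a * u.1 + b u.2, u.2)%R * `|a|%:E) = \int[mu2]_u G u)%E.
Proof.
move=> a0 mb mG G0; apply: eq_ge0_integral_fibre1 => //.
- apply: emeasurable_funM => //; apply: (measurableT_comp mG).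
  apply: measurable_fun_pair => //; apply: measurable_funD.
    exact: measurable_funM.
  exact: measurableT_comp.
- by move=> u; rewrite mule_ge0// lee_fin.
- move=> y /=; apply: (@ge0_integral_affine _ a (b y) (fun x => G (x, y))) => //.
  exact: measurableT_comp.
Qed.

Lemma ge0_integral_affine2 (d b : R -> R) G :
  (forall x, x != 0 -> d x != 0) ->
  measurable_fun [set: T] (d : T -> T) -> measurable_fun [set: T] (b : T -> T) ->
  measurable_fun setT G -> (forall u, (0 <= G u)%E) ->
  (\int[mu2]_u (G (u.1, d u.1 * u.2 + b u.1)%R * `|d u.1|%:E) =
   \int[mu2]_u G u)%E.
Proof.
move=> d0 md mb mG G0; apply: eq_ge0_integral_fibre2 => //.
- apply: emeasurable_funM => //.
    apply: (measurableT_comp mG).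
    apply: measurable_fun_pair => //; apply: measurable_funD.
      by apply: measurable_funM => //; exact: measurableT_comp.
    exact: measurableT_comp.
  by apply/measurable_EFinP; do 2 apply: measurableT_comp => //.
- by move=> u; rewrite mule_ge0// lee_fin.
- move=> x x0 /=.
  apply: (@ge0_integral_affine _ (d x) (b x) (fun y => G (x, y))) => //.
    exact: d0.
  exact: measurableT_comp.
Qed.

Lemma ge0_integral_translation (p q : R) G :
  measurable_fun setT G -> (forall u, (0 <= G u)%E) ->
  (\int[mu2]_u G (u.1 + p, u.2 + q)%R = \int[mu2]_u G u)%E.
Proof.
move=> mG G0.
rewrite -[RHS](@ge0_integral_affine1 1 (cst p))//; try exact: oner_neq0.
rewrite -[RHS](@ge0_integral_affine2 (cst 1) (cst q))//=.
- by apply: eq_integral => u _; rewrite normr1 !mule1 !mul1r.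
- rewrite normr1; under eq_fun do rewrite mule1.
  apply: (measurableT_comp mG); apply: measurable_fun_pair => //=.
  by apply: measurable_funD => //; exact: measurable_funM.
- by move=> u; rewrite normr1 mule1.
Qed.

(** Multiplication by a + ib is (x, y) |-> (a x - b y, y) followed by
    (x, y) |-> (x, (b / a) x + ((a ^ 2 + b ^ 2) / a) y). *)
Lemma ge0_integral_cmul_re (a b : R) G : a != 0 ->
  measurable_fun setT G -> (forall u, (0 <= G u)%E) ->
  (\int[mu2]_u (G (a * u.1 - b * u.2, b * u.1 + a * u.2)%R * (a ^+ 2 + b ^+ 2)%:E) =
   \int[mu2]_u G u)%E.
Proof.
move=> a0 mG G0.
have ab0 : (a ^+ 2 + b ^+ 2) / a != 0.
  by rewrite mulf_neq0 ?invr_eq0// gt_eqF// ltr_pwDl ?sqr_ge0// exprn_even_gt0.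
have mb (x : R) : measurable_fun [set: T] (fun y => x * y : T).
  exact: measurable_funM.
rewrite -[RHS](@ge0_integral_affine2 (cst ((a ^+ 2 + b ^+ 2) / a)) (fun x => b / a * x))//.
rewrite -[RHS](@ge0_integral_affine1 a (fun y => - b * y))//=.
- apply: eq_integral => u _; rewrite mulNr -muleA -EFinM -normrM divfK//.
  rewrite ger0_norm; last by rewrite addr_ge0 ?sqr_ge0.
  congr (G (_, _) * _)%E; field; exact: a0.
- apply: emeasurable_funM => //; apply: (measurableT_comp mG).
  apply: measurable_fun_pair => //.
  apply: measurable_funD => //; first exact: measurable_funM.
  exact: (measurableT_comp (mb _)).
- by move=> u; rewrite mule_ge0// lee_fin.
Qed.

Lemma measurable_slope G : measurable_fun setT G ->
  measurable_fun setT (fun u : T * T => G (u.1, u.1 * u.2)%R * `|u.1|%:E)%E.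
Proof.
move=> mG; apply: emeasurable_funM.
  apply: (measurableT_comp mG); apply: measurable_fun_pair => //.
  exact: measurable_funM.
by apply/measurable_EFinP; do 2 apply: measurableT_comp => //.
Qed.

Lemma slope_ge0 G (u : T * T) : (forall u, 0 <= G u)%E ->
  (0 <= G (u.1, u.1 * u.2)%R * `|u.1|%:E)%E.
Proof. by move=> G0; rewrite mule_ge0// lee_fin. Qed.

(** The coordinates x and m = y / x, for which the inversion acts on each
    coordinate almost separately. *)
Lemma ge0_integral_slope G :
  measurable_fun setT G -> (forall u, (0 <= G u)%E) ->
  (\int[mu2]_u G u = \int[mu2]_u (G (u.1, u.1 * u.2)%R * `|u.1|%:E))%E.
Proof.
move=> mG G0; rewrite -[LHS](@ge0_integral_affine2 id (cst 0))//.
by apply: eq_integral => u _; rewrite /= addr0.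
Qed.

(** The map z |-> 1 / z, of Jacobian |z| ^ -4. In the coordinates x and m = y / x
    it reads (x, m) |-> (1 / ((1 + m ^ 2) x), - m), so that a reflection, a
    dilation and the reciprocal on the line are enough. *)
Lemma ge0_integral_inversion G :
  measurable_fun setT G -> (forall u, (0 <= G u)%E) ->
  (\int[mu2]_u (G (u.1 / (u.1 ^+ 2 + u.2 ^+ 2), - u.2 / (u.1 ^+ 2 + u.2 ^+ 2))%R *
     ((u.1 ^+ 2 + u.2 ^+ 2)^-1 ^+ 2)%:E) = \int[mu2]_u G u)%E.
Proof.
move=> mG G0.
have mD : measurable_fun [set: T * T] (fun u => u.1 ^+ 2 + u.2 ^+ 2 : T).
  by apply: measurable_funD; exact: measurable_funX.
have mDV : measurable_fun [set: T * T] (fun u => (u.1 ^+ 2 + u.2 ^+ 2)^-1 : T).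
  exact: measurableT_comp measurable_inv mD.
set L := (fun u => (G (_, _) * _)%E).
have mL : measurable_fun setT L.
  apply: emeasurable_funM.
    apply: (measurableT_comp mG); apply: measurable_fun_pair => //;
      apply: measurable_funM => //.
    exact: measurableT_comp.
  by apply/measurable_EFinP; exact: measurable_funX.
have L0 u : (0 <= L u)%E by rewrite mule_ge0// lee_fin exprn_ge0// invr_ge0 addr_ge0 ?sqr_ge0.
have refl (H : T * T -> \bar R) : measurable_fun setT H -> (forall u, 0 <= H u)%E ->
    (\int[mu2]_u H u = \int[mu2]_u (H (u.1, - u.2)%R))%E.
  move=> mH H0; rewrite -[LHS](@ge0_integral_affine2 (cst (-1)) (cst 0))//.
    by apply: eq_integral => u _; rewrite /= addr0 mulN1r normrN1 mule1.
  by move=> x _ /=; rewrite oppr_eq0 oner_eq0.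
rewrite (ge0_integral_slope mL L0) (ge0_integral_slope mG G0) (refl _ (measurable_slope mL) (fun u => slope_ge0 u L0)).
apply: eq_ge0_integral_fibre1.
- apply: (measurableT_comp (measurable_slope mL)).
  by apply: measurable_fun_pair => //=; exact: measurableT_comp.
- by move=> u; exact: (slope_ge0 (_, _) L0).
- exact: measurable_slope.
- by move=> u; exact: slope_ge0.
move=> m /=.
have s0 : 0 < 1 + m ^+ 2 by rewrite ltr_pwDl ?sqr_ge0.
have mKm : measurable_fun [set: T] (fun x : T => G (x, x * m)%R * `|x|%:E)%E.
  exact: (measurableT_comp (measurable_slope mG) (measurable_fun_pair (@measurable_id _ _ _) (measurable_cst m))).
rewrite -[RHS]ge0_integral_recip//; last by move=> x; exact: (slope_ge0 (x, m)).
rewrite -[RHS](@ge0_integral_affine _ (1 + m ^+ 2) 0)//; last 3 first.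
- by rewrite gt_eqF.
- apply: emeasurable_funM.
    exact: (measurableT_comp mKm measurable_inv).
  by apply/measurable_EFinP/measurable_funX; exact: measurable_inv.
- move=> x; rewrite mule_ge0// ?lee_fin ?exprn_even_ge0//; exact: (slope_ge0 (_, m)).
apply: eq_integral => t _; rewrite /L/= !addr0.
have [->|t0] := eqVneq t 0.
  by rewrite normr0 mulr0 invr0 expr0n/= !mule0 mul0e.
have E : t ^+ 2 + (t * - m) ^+ 2 = (1 + m ^+ 2) * t * t by ring.
rewrite E -!muleA -!EFinM.
have E1 : t / ((1 + m ^+ 2) * t * t) = ((1 + m ^+ 2) * t)^-1.
  by field; rewrite t0 gt_eqF.
have E2 : - (t * - m) / ((1 + m ^+ 2) * t * t) = ((1 + m ^+ 2) * t)^-1 * m.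
  by field; rewrite t0 gt_eqF.
rewrite E1 E2; congr (_ * _%:E)%E.
rewrite normfV normrM (gtr0_norm s0).
have tt : t ^+ 2 = `|t| ^+ 2 by rewrite -normrX ger0_norm ?sqr_ge0.
have -> : ((1 + m ^+ 2) * t * t)^-1 ^+ 2 = ((1 + m ^+ 2) * t ^+ 2)^-1 ^+ 2.
  by rewrite -mulrA.
have -> : ((1 + m ^+ 2) * t)^-1 ^+ 2 = ((1 + m ^+ 2) ^+ 2 * t ^+ 2)^-1.
  by rewrite exprVn exprMn.
rewrite tt; field; by rewrite normr_eq0 t0 gt_eqF.
Qed.

End two_variables.

(** * Integration over the complex plane *)

Section complex_integral.
Local Open Scope classical_set_scope.
Local Open Scope ring_scope.
Context {R : realType}.
Local Notation C := R[i].
Local Notation nrm := (@Normc.normc R).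
Local Notation T := (measurableTypeR R).
Local Notation mu2 := ((@lebesgue_measure R \x @lebesgue_measure R)%E).
Implicit Types (F G : C -> \bar R) (z w : C).

Definition cint F : \bar R := (\int[mu2]_u F (Complex u.1 u.2))%E.
Definition cmeas F := measurable_fun [set: T * T] (fun u => F (Complex u.1 u.2)).

Lemma nrm_ge0 z : 0 <= nrm z. Proof. by case: z => x y; exact: sqrtr_ge0. Qed.
#[local] Hint Resolve nrm_ge0 : core.

Lemma nrm_eq0 z : (nrm z == 0) = (z == 0).
Proof.
by apply/eqP/eqP => [/Normc.eq0_normc//|->]; exact: Normc.normc0.
Qed.

Lemma nrm_gt0 z : (0 < nrm z) = (z != 0).
Proof. by rewrite lt_def nrm_ge0 andbT nrm_eq0. Qed.

Lemma sqr_nrm (x y : R) : nrm (Complex x y) ^+ 2 = x ^+ 2 + y ^+ 2.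
Proof. by rewrite /= sqr_sqrtr// addr_ge0 ?sqr_ge0. Qed.

Lemma nrmN z : nrm (- z) = nrm z.
Proof. by case: z => x y /=; rewrite !sqrrN. Qed.

Lemma nrmX z n : nrm (z ^+ n) = nrm z ^+ n.
Proof. by elim: n => [|n IHn]; [exact: Normc.normc1|rewrite !exprS Normc.normcM IHn]. Qed.

Lemma cmeas_comp F (f g : R * R -> R) :
  measurable_fun [set: T * T] (f : T * T -> T) -> measurable_fun [set: T * T] (g : T * T -> T) ->
  cmeas F -> measurable_fun [set: T * T] (fun u => F (Complex (f u) (g u))).
Proof.
move=> mf mg mF.
exact: (measurableT_comp (f := (fun u => F (Complex u.1 u.2))) mF (measurable_fun_pair mf mg)).
Qed.

Lemma cmeas_add F w : cmeas F -> cmeas (fun z => F (z + w)).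
Proof.
by case: w => p q mF; apply: (cmeas_comp _ _ mF); exact: measurable_funD.
Qed.

Lemma cmeas_mul F w : cmeas F -> cmeas (fun z => F (w * z)).
Proof.
case: w => p q mF; apply: (cmeas_comp _ _ mF).
  by apply: measurable_funB; exact: measurable_funM.
by apply: measurable_funD; exact: measurable_funM.
Qed.

Lemma cmeas_mulr F G : cmeas F -> cmeas G -> cmeas (fun z => F z * G z)%E.
Proof. by move=> mF mG; exact: emeasurable_funM. Qed.

Lemma cmeas_inv F : cmeas F -> cmeas (fun z => F z^-1).
Proof.
move=> mF.
have mDV : measurable_fun [set: T * T] (fun u => (u.1 ^+ 2 + u.2 ^+ 2)^-1 : T).
  apply: (measurableT_comp measurable_inv).
  by apply: measurable_funD; exact: measurable_funX.
apply: (cmeas_comp _ _ mF); first exact: measurable_funM.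
by apply: measurable_funN; exact: measurable_funM.
Qed.

Lemma cint_add F w : cmeas F -> (forall z, (0 <= F z)%E) ->
  cint (fun z => F (z + w)) = cint F.
Proof.
case: w => p q mF F0.
exact: (@ge0_integral_translation R p q (fun u => F (Complex u.1 u.2))).
Qed.

Let cint_mul_re F w : complex.Re w != 0 -> cmeas F -> (forall z, (0 <= F z)%E) ->
  cint (fun z => F (w * z)%R * (nrm w ^+ 2)%:E)%E = cint F.
Proof.
case: w => a b /= a0 mF F0; rewrite sqr_sqrtr ?addr_ge0 ?sqr_ge0//.
rewrite /cint -(@ge0_integral_cmul_re R a b (fun u => F (Complex u.1 u.2)))//.
by apply: eq_integral => u _; congr (F (Complex _ _) * _)%E; rewrite addrC.
Qed.

Lemma cint_mul F w : w != 0 -> cmeas F -> (forall z, (0 <= F z)%E) ->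
  cint (fun z => F (w * z)%R * (nrm w ^+ 2)%:E)%E = cint F.
Proof.
case: w => a b w0 mF F0; have [a0|a0] := eqVneq a 0; last exact: cint_mul_re.
have b0 : b != 0 by apply: contra w0 => /eqP ->; rewrite a0.
(* A purely imaginary number is (1 + i) times another number off the axis. *)
rewrite -[RHS](@cint_mul_re _ (Complex 1 1))//; last exact: oner_neq0.
rewrite -[RHS](@cint_mul_re _ (Complex (b / 2) (b / 2)))//; first last.
- by move=> z; rewrite mule_ge0// lee_fin exprn_ge0.
- by apply: cmeas_mulr; [exact: cmeas_mul|exact: measurable_cst].
- by rewrite /= mulf_neq0// invr_eq0 pnatr_eq0.
congr cint; apply/funext => z.
rewrite mulrA -muleA -EFinM -exprMn -Normc.normcM.
suff -> : Complex 1 1 * Complex (b / 2) (b / 2) = Complex a b by [].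
by rewrite a0; congr Complex; lra.
Qed.

Lemma cint_inv F : cmeas F -> (forall z, (0 <= F z)%E) ->
  cint (fun z => F z^-1%R * ((nrm z)^-1 ^+ 4)%:E)%E = cint F.
Proof.
move=> mF F0.
rewrite /cint -(@ge0_integral_inversion R (fun u => F (Complex u.1 u.2)))//.
apply: eq_integral => -[x y] _; rewrite [(x, y).1]/= [(x, y).2]/=.
rewrite (exprM _ 2 2) exprVn sqr_nrm; congr (F (Complex _ _) * _)%E.
by rewrite mulNr.
Qed.

Lemma eq_cint F G : cmeas F -> cmeas G ->
  (forall z, (0 <= F z)%E) -> (forall z, (0 <= G z)%E) ->
  (forall z, z != 0 -> F z = G z) -> cint F = cint G.
Proof.
move=> mF mG F0 G0 FG; apply: eq_ge0_integral_fibre2 => // x x0.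
apply: eq_integral => y _; apply: FG; apply: contra x0 => /eqP.
by case=> ->.
Qed.

Lemma cmeas_nrm (p q : C) : cmeas (fun z => (nrm (p * z + q))%:E).
Proof.
apply/measurable_EFinP.
rewrite (_ : (fun _ => _) = (fun u : T * T =>
   ((complex.Re p * u.1 - complex.Im p * u.2 + complex.Re q) ^+ 2 +
    (complex.Re p * u.2 + complex.Im p * u.1 + complex.Im q) ^+ 2) `^ 2^-1)).
  apply: (measurableT_comp (@measurable_powR R 2^-1)).
  apply: measurable_funD; apply: measurable_funX; apply: measurable_funD => //.
    by apply: measurable_funB; exact: measurable_funM.
  by apply: measurable_funD; exact: measurable_funM.
apply/funext => u; rewrite powR12_sqrt ?addr_ge0 ?sqr_ge0//.
by case: p => p1 p2; case: q => q1 q2.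
Qed.

Lemma cmeasXz (f : C -> R) (k : int) : cmeas (EFin \o f) -> cmeas (fun z => (f z ^ k)%:E).
Proof.
move=> /measurable_EFinP mf; apply/measurable_EFinP.
case: k => n; first exact: measurable_funX.
by apply: (measurableT_comp measurable_inv); exact: measurable_funX.
Qed.

Lemma cmeas_prod n (f : 'I_n -> C -> R) : (forall i, cmeas (EFin \o f i)) ->
  cmeas (fun z => (\prod_(i < n) f i z)%:E).
Proof.
move=> mf; apply/measurable_EFinP.
rewrite (_ : (fun _ => _) = (fun u : T * T => \prod_(i < n) f i (Complex u.1 u.2))).
  by apply: measurable_prod => i _; apply/measurable_EFinP; exact: mf.
by [].
Qed.

End complex_integral.
#[local] Hint Resolve nrm_ge0 : core.

(** * Moebius changes of variable *)

Lemma det2 (K : comRingType) (g : 'M[K]_2) :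
  (\det g = g ord0 ord0 * g ord_max ord_max - g ord0 ord_max * g ord_max ord0)%R.
Proof.
rewrite (expand_det_row _ ord0) !big_ord_recl big_ord0 /cofactor !det_mx11 !mxE/=.
rewrite expr0 mul1r addr0 expr1 mulN1r mulrN.
by congr (_ * g _ _ - g _ _ * g _ _)%R; exact: val_inj.
Qed.

Section moebius_invariance.
Local Open Scope classical_set_scope.
Local Open Scope ring_scope.
Context {R : realType}.
Local Notation C := R[i].
Local Notation nrm := (@Normc.normc R).
Variable F : 'rV[C]_2 -> R.
Hypothesis F0 : forall v, 0 <= F v.
Hypothesis Fhom : forall l v, l != 0 -> F (l *: v) = (nrm l)^-1 ^+ 4 * F v.
Hypothesis Fmeas : forall p q s t : C,
  cmeas (fun z => (F (\row_(j < 2) if j == ord0 then p * z + s else q * z + t))%:E).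

Let rw (x y : C) : 'rV[C]_2 := \row_(j < 2) if j == ord0 then x else y.
Let G (z : C) := (F (affine z))%:E.
Let mG : cmeas G.
Proof.
have := Fmeas 1 0 0 1; congr (cmeas _); apply/funext => z.
by rewrite /G /affine mul1r addr0 mul0r add0r.
Qed.
Let G0 z : (0 <= G z)%E. Proof. by rewrite lee_fin. Qed.

Let Frw x y : y != 0 -> (F (rw x y))%:E = (((nrm y)^-1 ^+ 4)%:E * G (x / y)%R)%E.
Proof.
move=> y0; rewrite -EFinM -Fhom//; congr (F _)%:E.
apply/rowP => j; rewrite !mxE; case: ifP => _; last by rewrite mulr1.
by rewrite mulrC divfK.
Qed.

Let cint_zoom (K : C -> \bar R) p q : p != 0 -> cmeas K -> (forall z, (0 <= K z)%E) ->
  cint (fun z => K (p * z + q)%R * (nrm p ^+ 2)%:E)%E = cint K.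
Proof.
move=> p0 mK K0; rewrite -[RHS](cint_add q)//.
by rewrite -[RHS](cint_mul p0)//; exact: cmeas_add.
Qed.

(** If q = 0 the map z |-> (p z + s) / (q z + t) is affine; otherwise it is an
    affine map, the inversion and again an affine map. The homogeneity of F,
    of degree -4, absorbs the Jacobian of the inversion. *)
Lemma cint_moebius (g : 'M[C]_2) : g \in unitmx ->
  cint (fun z => (F (affine z *m g) * nrm (\det g) ^+ 2)%:E) =
  cint (fun z => (F (affine z))%:E).
Proof.
rewrite unitmxE unitfE det2.
set p := g ord0 ord0; set q := g ord0 ord_max.
set s := g ord_max ord0; set t := g ord_max ord_max => d0.
have gE z : affine z *m g = rw (p * z + s) (q * z + t).
  apply/rowP => j; rewrite !mxE !big_ord_recl big_ord0 !mxE/= addr0 mul1r mulrC.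
  have -> : lift ord0 ord0 = ord_max :> 'I_2 by exact: val_inj.
  case: ifPn => [/eqP->//|j0].
  by have -> : j = ord_max by apply: val_inj; case: j j0 => -[|[|]].
under [in LHS]eq_fun do rewrite gE EFinM.
have [q0|q0] := eqVneq q 0.
  rewrite q0 mul0r subr0 in d0 *.
  have := d0; rewrite mulf_eq0 negb_or => /andP[p0 t0].
  rewrite -[RHS](@cint_zoom G (p / t) (s / t))//; last by rewrite mulf_neq0 ?invr_eq0.
  congr cint; apply/funext => z.
  rewrite mul0r add0r Frw// /G -!EFinM; congr EFin.
  rewrite [(p * z + s) / t]mulrDl [p * z / t]mulrAC !Normc.normcM Normc.normcV.
  by have := nrm_gt0 t; rewrite t0 => /lt0r_neq0 ?; field.
pose d := p * t - q * s.
pose K w := (F (rw (p / q * w - d / q) w))%:E.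
have mK : cmeas K by have := Fmeas (p / q) 1 (- (d / q)) 0;
  congr (cmeas _); apply/funext => w; rewrite /K mul1r addr0.
have K0 w : (0 <= K w)%E by rewrite lee_fin.
have dq0 : - (d / q) != 0 by rewrite oppr_eq0 mulf_neq0 ?invr_eq0.
transitivity (cint (fun z => K z * (nrm (- (d / q)) ^+ 2)%:E)%E).
  rewrite -[RHS](@cint_zoom _ q t)//; first last.
  - by move=> z; apply: mule_ge0 => //; rewrite lee_fin exprn_ge0 ?nrm_ge0.
  - by apply: cmeas_mulr; [|exact: measurable_cst].
  congr cint; apply/funext => z.
  rewrite -muleA -EFinM /K; congr ((F (rw _ _))%:E * _%:E)%E.
    by rewrite /d; field.
  rewrite -exprMn nrmN Normc.normcM Normc.normcV divfK//.
  by rewrite nrm_eq0.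
rewrite -[RHS](@cint_zoom G (- (d / q)) (p / q))//.
rewrite -[RHS]cint_inv//; first last.
- by move=> z; apply: mule_ge0 => //; rewrite lee_fin exprn_ge0 ?nrm_ge0.
- apply: cmeas_mulr; last exact: measurable_cst.
  by apply: cmeas_mul (cmeas_add _ _).
apply: eq_cint.
- by apply: cmeas_mulr; [|exact: measurable_cst].
- apply: cmeas_mulr.
    apply: (@cmeas_inv _ (fun z => G (- (d / q) * z + p / q)%R * (nrm (- (d / q)) ^+ 2)%:E)%E).
    apply: cmeas_mulr; last exact: measurable_cst.
    by apply: cmeas_mul (cmeas_add _ _).
  have := cmeasXz (Negz 3) (cmeas_nrm (1 : C) 0).
  rewrite (_ : (fun _ => _) = (fun z => ((nrm z)^-1 ^+ 4)%:E))//.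
  by apply/funext => z; rewrite mul1r addr0 exprVn.
- by move=> z; apply: mule_ge0 => //; rewrite lee_fin exprn_ge0 ?nrm_ge0.
- by move=> z; do 2 ?[apply: mule_ge0 => //]; rewrite lee_fin exprn_ge0 ?invr_ge0 ?nrm_ge0.
move=> w w0; rewrite /K Frw//.
have -> : (p / q * w - d / q) / w = - (d / q) / w + p / q.
  by rewrite mulrDl mulfK// addrC.
by rewrite -muleA muleC.
Qed.

End moebius_invariance.

(** * Isomorphism invariance of the flat area *)

Section flat_area.
Local Open Scope classical_set_scope.
Local Open Scope ring_scope.
Context {R : realType} {r : nat}.
Variable k : 'I_r -> int.
Local Notation C := R[i].
Local Notation nrm := (@Normc.normc R).
Local Notation qdata := (C * 'M[C]_(r, 2))%type.
Implicit Types (a b : qdata) (v w : 'rV[C]_2).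

Lemma flat_areaE a : flat_area k a = cint (fun z => (nrm (qcoef k a (affine z)))%:E).
Proof. by []. Qed.

Lemma nrm_prod (I : Type) (s : seq I) (f : I -> C) :
  nrm (\prod_(i <- s) f i) = \prod_(i <- s) nrm (f i).
Proof. by elim/big_ind2: _ => [|x x' y y' <- <-|]//; [exact: Normc.normc1|exact: Normc.normcM]. Qed.

Lemma nrmXz (z : C) (n : int) : nrm (z ^ n) = nrm z ^ n.
Proof. by case: n => n; rewrite /exprz/= ?Normc.normcV nrmX. Qed.

Lemma nrm_qcoef a v :
  nrm (qcoef k a v) = nrm a.1 * \prod_(i < r) nrm (wedge v (sing a i)) ^ k i.
Proof.
rewrite /qcoef Normc.normcM nrm_prod; congr (_ * _).
by apply: eq_bigr => i _; rewrite nrmXz.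
Qed.

Lemma wedgeZl (l : C) v w : wedge (l *: v) w = l * wedge v w.
Proof. by rewrite /wedge !mxE; ring. Qed.

Lemma wedgeZr (l : C) v w : wedge v (l *: w) = l * wedge v w.
Proof. by rewrite /wedge !mxE; ring. Qed.

Lemma wedgeC v w : wedge w v = - wedge v w.
Proof. by rewrite /wedge; ring. Qed.

Lemma wedgevv v : wedge v v = 0.
Proof. by rewrite /wedge; ring. Qed.

Lemma wedge_mulmx v w (g : 'M[C]_2) : wedge (v *m g) (w *m g) = wedge v w * \det g.
Proof.
rewrite /wedge det2 !mxE !big_ord_recl !big_ord0.
have -> : lift ord0 ord0 = ord_max :> 'I_2 by exact: val_inj.
by ring.
Qed.

Hypothesis ksum : \sum_(i < r) k i = -4.

Lemma prod_exprz (K : fieldType) (l : K) : l != 0 -> \prod_(i < r) l ^ k i = l ^- 4.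
Proof.
move=> l0; rewrite -[RHS]/(l ^ (Negz 3)) (_ : Negz 3 = \sum_(i < r) k i); last by rewrite ksum.
by elim/big_rec2: _ => [|i x y _ ->]; rewrite ?expr0z// expfzDr.
Qed.

Lemma qcoefZ a (l : C) v : l != 0 -> qcoef k a (l *: v) = l ^- 4 * qcoef k a v.
Proof.
move=> l0; rewrite /qcoef -prod_exprz// mulrCA -big_split/=; congr (_ * _).
by apply: eq_bigr => i _; rewrite wedgeZl expfzMl.
Qed.

Lemma cmeas_qcoef a (p q s t : C) : cmeas (fun z => (nrm (qcoef k a
   (\row_(j < 2) if j == ord0 then p * z + s else q * z + t)))%:E).
Proof.
under eq_fun do rewrite nrm_qcoef EFinM.
set v := fun z : C => \row_(j < 2) if j == ord0 then p * z + s else q * z + t.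
suff mP : cmeas (fun z => (\prod_(i < r) nrm (wedge (v z) (sing a i)) ^ k i)%:E).
  by apply: (cmeas_mulr (F := cst (nrm a.1)%:E) _ mP); exact: measurable_cst.
apply: (@cmeas_prod R r (fun i z => nrm (wedge (v z) (sing a i)) ^ k i)) => i.
apply: (@cmeasXz R (fun z => nrm (wedge (v z) (sing a i)))).
pose w := sing a i.
have := cmeas_nrm (p * w ord0 ord_max - q * w ord0 ord0) (s * w ord0 ord_max - t * w ord0 ord0).
suff -> : (fun z => (nrm ((p * w ord0 ord_max - q * w ord0 ord0) * z +
    (s * w ord0 ord_max - t * w ord0 ord0)))%:E) =
  EFin \o (fun z => nrm (wedge (v z) (sing a i))) by [].
by apply/funext => z /=; congr (nrm _)%:E; rewrite /wedge !mxE/=; ring.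
Qed.

Lemma cmeas_area a : cmeas (fun z => (nrm (qcoef k a (affine z)))%:E).
Proof.
have -> : (fun z => (nrm (qcoef k a (affine z)))%:E) = (fun z => (nrm (qcoef k a
   (\row_(j < 2) if j == ord0 then 1 * z + 0 else 0 * z + 1)))%:E).
  by apply/funext => z; rewrite mul1r addr0 mul0r add0r.
exact: cmeas_qcoef.
Qed.

Lemma flat_area_pullback a b (g : 'M[C]_2) : g \in unitmx ->
  (forall v, qcoef k b (v *m g) * \det g ^+ 2 = qcoef k a v) ->
  flat_area k a = flat_area k b.
Proof.
move=> gu gE; rewrite !flat_areaE -[RHS](@cint_moebius R (fun v => nrm (qcoef k b v)) _ _ _ g)//.
- by congr cint; apply/funext => z; rewrite -gE Normc.normcM nrmX.
- by move=> v; exact: nrm_ge0.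
- by move=> l v l0; rewrite qcoefZ// Normc.normcM -Normc.normcV -nrmX exprVn.
- exact: cmeas_qcoef.
Qed.

Lemma flat_area_isomorphic a b : isomorphic k a b -> flat_area k a = flat_area k b.
Proof. by move=> [g [s [gu _ _ qE]]]; exact: flat_area_pullback gu qE. Qed.

Lemma flat_area_scale (c : C) a :
  flat_area k (c * a.1, a.2) = ((nrm c)%:E * flat_area k a)%E.
Proof.
rewrite !flat_areaE /cint -ge0_integralZl//.
- apply: eq_integral => u _; rewrite -EFinM -Normc.normcM /qcoef/= mulrA.
  by congr (nrm (_ * _))%:E; apply: eq_bigr => i _.
- exact: cmeas_area.
- by move=> u _; rewrite lee_fin nrm_ge0.
- by rewrite lee_fin nrm_ge0.
Qed.

(** The image of [a] by the Moebius map of [g], with representatives rescaled by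
    [l]; the constant is the one for which the differential is transported. *)
Definition moebius (g : 'M[C]_2) (l : 'I_r -> C) a : qdata :=
  (a.1 * \det g ^+ 2 * \prod_(i < r) l i ^ (- k i), \matrix_(i, j) (l i *: (sing a i *m g)) ord0 j).

Lemma sing_moebius g l a i : sing (moebius g l a) i = l i *: (sing a i *m g).
Proof. by apply/rowP => j; rewrite !mxE. Qed.

Lemma qcoef_moebius g l a v : g \in unitmx -> (forall i, l i != 0) ->
  qcoef k (moebius g l a) (v *m g) * \det g ^+ 2 = qcoef k a v.
Proof.
rewrite unitmxE unitfE => g0 l0; rewrite /qcoef /=.
have -> : \prod_(i < r) wedge (v *m g) (sing (moebius g l a) i) ^ k i =
  (\prod_(i < r) l i ^ k i) * (\prod_(i < r) wedge v (sing a i) ^ k i) * (\det g) ^- 4.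
  rewrite -prod_exprz// -!big_split/=; apply: eq_bigr => i _.
  by rewrite sing_moebius wedgeZr wedge_mulmx !expfzMl mulrA.
have L : (\prod_(i < r) l i ^ (- k i)) * (\prod_(i < r) l i ^ k i) = 1.
  by rewrite -big_split/= big1// => i _; rewrite -expfzDr// addNr expr0z.
set P := \prod_(i < r) l i ^ (- k i) in L *; set Q := \prod_(i < r) l i ^ k i in L *.
rewrite -[RHS]mulr1 -[X in _ = _ * X]L.
set S := \prod_(i < r) _; field; exact: g0.
Qed.

Lemma isomorphic_moebius g l a : g \in unitmx -> (forall i, l i != 0) ->
  isomorphic k a (moebius g l a).
Proof.
move=> gu l0; exists g, 1%g; split => // [i|i|v]; first by rewrite perm1.
- by exists (l i) => //; rewrite perm1 sing_moebius.
- exact: qcoef_moebius.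
Qed.

End flat_area.

(** * Dominated convergence under varying bounds *)

Section moving_dominated_convergence.
Local Open Scope classical_set_scope.
Local Open Scope ring_scope.
Context d (T : measurableType d) (R : realType).
Variable mu : {measure set T -> \bar R}.
Variables (f_ g_ : nat -> T -> R) (f g : T -> R).
Hypotheses (mf_ : forall n, measurable_fun setT (f_ n)) (mf : measurable_fun setT f).
Hypotheses (mg_ : forall n, measurable_fun setT (g_ n)) (mg : measurable_fun setT g).
Hypotheses (f0 : forall x, 0 <= f x) (f_0 : forall n x, 0 <= f_ n x).
Hypotheses (g_0 : forall n x, 0 <= g_ n x) (g0 : forall x, 0 <= g x).
Hypothesis f_f : {ae mu, forall x, f_ ^~ x @ \oo --> f x}.
Hypothesis g_g : {ae mu, forall x, g_ ^~ x @ \oo --> g x}.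
Hypothesis f_g_ : forall n x, f_ n x <= g_ n x.
Hypothesis ig : (\int[mu]_x (g x)%:E < +oo)%E.
Hypothesis ig_ : forall n, (\int[mu]_x (g_ n x)%:E = \int[mu]_x (g x)%:E)%E.

Let intg : mu.-integrable setT (EFin \o g).
Proof.
apply/integrableP; split; first exact/measurable_EFinP.
by under eq_integral do rewrite /= ger0_norm//.
Qed.

Let trunc_cvg (h_ : nat -> T -> R) (h : T -> R) :
  (forall n, measurable_fun setT (h_ n)) -> measurable_fun setT h ->
  (forall n x, 0 <= h_ n x) -> {ae mu, forall x, h x <= g x} ->
  {ae mu, forall x, h_ ^~ x @ \oo --> h x} ->
  (\int[mu]_x (Num.min (h_ n x) (g x))%:E @[n --> \oo] --> \int[mu]_x (h x)%:E)%E.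
Proof.
move=> mh_ mh h_0 hg hcvg.
have [] // := @dominated_convergence _ T R mu setT measurableT
  (fun n x => (Num.min (h_ n x) (g x))%:E) (EFin \o h) (EFin \o g).
- by move=> n; apply/measurable_EFinP/measurable_minr.
- exact/measurable_EFinP.
- near=> x => _; apply: cvg_EFin; first exact: nearW.
  rewrite [X in _ --> X](_ : _ = Num.min (h x) (g x)); last first.
    by apply/esym/min_idPl; near: x.
  have hx : h_ ^~ x @ \oo --> h x by near: x.
  exact: (cvg_comp _ _ (cvg_pair hx (cvg_cst (g x))) (@min_continuous _ R (h x, g x))).
- apply: aeW => x n _ /=; rewrite lee_fin ger0_norm ?le_min ?h_0 ?g0//.
  by rewrite ge_min lexx orbT.
Unshelve. all: by end_near. Qed.

Let split_min (u v : R) : u = Num.min u v + Num.max (u - v) 0.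
Proof.
case: (leP u v) => uv; first by rewrite max_r ?subr_le0// addr0.
by rewrite max_l ?subr_ge0 ?(ltW uv)// addrC subrK.
Qed.

Let int_split (h : T -> R) : measurable_fun setT h -> (forall x, 0 <= h x) ->
  (\int[mu]_x (h x)%:E = \int[mu]_x (Num.min (h x) (g x))%:E +
    \int[mu]_x (Num.max (h x - g x) 0)%:E)%E.
Proof.
move=> mh h0; rewrite -ge0_integralD//.
- by apply: eq_integral => x _; rewrite -EFinD -split_min.
- by move=> x _; rewrite lee_fin le_min h0 g0.
- by apply/measurable_EFinP/measurable_minr.
- by move=> x _; rewrite lee_fin le_max lexx orbT.
- by apply/measurable_EFinP/measurable_maxr => //; exact: measurable_funB.
Qed.

(** Truncation at g brings back the usual theorem. The excess of f_ n over g is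
    at most that of g_ n, and the integral of the latter is the integral of g
    minus that of the minimum of g_ n and g, which tends to 0. The bounds have
    to move because the kernels that dominate an area density are centred at
    the singularities. *)
Lemma cvg_integral_moving_dominated :
  (\int[mu]_x (f_ n x)%:E @[n --> \oo] --> \int[mu]_x (f x)%:E)%E.
Proof.
have fg : {ae mu, forall x, f x <= g x}.
  near=> x; have fx : f_ ^~ x @ \oo --> f x by near: x.
  have gx : g_ ^~ x @ \oo --> g x by near: x.
  by apply: (ler_cvg_to fx gx); apply: nearW => n; exact: f_g_.
have cf := trunc_cvg mf_ mf f_0 fg f_f.
have cg := trunc_cvg mg_ mg g_0 (aeW _ (fun x => lexx _)) g_g.
have ifin : (\int[mu]_x (g x)%:E \is a fin_num)%E.
  by rewrite ge0_fin_numE// integral_ge0// => x _; rewrite lee_fin.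
set If := (\int[mu]_x (f x)%:E)%E; set Ig := (\int[mu]_x (g x)%:E)%E.
pose u n := (\int[mu]_x (Num.min (f_ n x) (g x))%:E)%E.
pose v n := (\int[mu]_x (Num.min (g_ n x) (g x))%:E)%E.
have vfin n : v n \is a fin_num.
  rewrite ge0_fin_numE; last by apply: integral_ge0 => x _; rewrite lee_fin le_min g_0 g0.
  apply: le_lt_trans ig; apply: ge0_le_integral => //.
  - by move=> x _; rewrite lee_fin le_min g_0 g0.
  - by apply/measurable_EFinP/measurable_minr.
  - exact/measurable_EFinP.
  - by move=> x _; rewrite lee_fin ge_min lexx orbT.
apply: (@squeeze_cvge _ _ _ _ u _ (fun n => u n + (Ig - v n))%E).
- apply: nearW => n; apply/andP; split.
    apply: ge0_le_integral => //.
    + by move=> x _; rewrite lee_fin le_min f_0 g0.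
    + by apply/measurable_EFinP/measurable_minr.
    + exact/measurable_EFinP.
    + by move=> x _; rewrite lee_fin ge_min lexx.
  rewrite (int_split (mf_ n) (f_0 n)) leeD2l// /Ig -(ig_ n) (int_split (mg_ n) (g_0 n)).
  rewrite -/(v n) [(v n + _)%E]addeC addeK//; apply: ge0_le_integral => //.
  + by move=> x _; rewrite lee_fin le_max lexx orbT.
  + by apply/measurable_EFinP/measurable_maxr => //; exact: measurable_funB.
  + by apply/measurable_EFinP/measurable_maxr => //; exact: measurable_funB.
  + move=> x _; rewrite lee_fin ge_max !le_max lexx !orbT andbT.
    by rewrite lerD2r f_g_.
- exact: cf.
- rewrite -[X in _ --> X]adde0 -(subee ifin).
  apply: cvgeD => //.
  + by rewrite subee// fin_num_adde_defl.
  + by apply: cvgeB => //; [rewrite fin_num_adde_defl// fin_numN|exact: cvg_cst].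
Unshelve. all: by end_near. Qed.

End moving_dominated_convergence.

(** * An integrable kernel *)

Section dominating_kernel.
Local Open Scope classical_set_scope.
Local Open Scope ring_scope.
Context {R : realType}.
Local Notation C := R[i].
Local Notation nrm := (@Normc.normc R).
Local Notation mu := (@lebesgue_measure R).
Local Notation T := (measurableTypeR R).

(** The value 1 at 0 is chosen for [exprz_pinv] to hold at d = 0. *)
Definition pinv (d : R) : R := if d == 0 then 1 else d^-1.

Lemma pinv_ge0 d : 0 <= d -> 0 <= pinv d.
Proof. by rewrite /pinv; case: ifP => // _ d0; rewrite invr_ge0. Qed.

Lemma measurable_pinv : measurable_fun [set: T] (pinv : T -> T).
Proof.
apply: measurable_fun_ifT => //; last exact: measurable_inv.
by apply: (measurable_fun_bool true); rewrite setTI (_ : _ @^-1` _ = [set 0])//; apply/seteqP; split => x /= /eqP.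
Qed.

(** Of order 1 / |w| at 0, as the density at a simple pole, and |w| ^ -3 at
    infinity, which is integrable and more than the density |w| ^ -4. *)
Definition ker (w : C) : R := pinv (nrm w) / (1 + nrm w ^+ 2).

Lemma ker_ge0 w : 0 <= ker w.
Proof. by rewrite divr_ge0 ?pinv_ge0 ?nrm_ge0// addr_ge0// sqr_ge0. Qed.

Lemma cmeas_ker (w : C) : cmeas (fun z => (ker (z + w))%:E).
Proof.
apply/measurable_EFinP.
have mn : measurable_fun [set: T * T] (fun u => nrm (Complex u.1 u.2 + w) : T).
  have /measurable_EFinP := cmeas_nrm 1 w.
  by under eq_fun do rewrite mul1r.
apply: measurable_funM; first exact: (measurableT_comp measurable_pinv).
apply: (measurableT_comp measurable_inv); apply: measurable_funD => //.
exact: measurable_funX.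
Qed.

Lemma integral_oneDsqr_lty : (\int[mu]_x ((1 + x ^+ 2)^-1)%:E < +oo)%E.
Proof.
rewrite (@ge0_symfun_integralT R (fun x => (1 + x ^+ 2)^-1)).
- rewrite -set_itvcy; have := @integral0y_oneDsqr R; rewrite /oneDsqr => ->.
  by rewrite -EFinM ltry.
- by move=> x; rewrite invr_ge0 addr_ge0// sqr_ge0.
- exact: continuous_oneDsqrV.
- by move=> x; rewrite /= sqrrN.
Qed.

(** In the coordinates x and m = y / x, with s = sqrt (1 + m ^ 2), the Jacobian
    absorbs the pole and leaves 1 / (s (1 + (s x) ^ 2)). Its integral in x is
    P / (1 + m ^ 2), where P is the integral of 1 / (1 + x ^ 2), so the whole
    is P ^ 2. *)
Lemma cint_ker_lty : (cint (fun z => (ker z)%:E) < +oo)%E.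
Proof.
have mker : measurable_fun [set: T * T] (fun u => (ker (Complex u.1 u.2))%:E).
  by have := cmeas_ker 0; rewrite /cmeas; under eq_fun do rewrite addr0.
rewrite /cint ge0_integral_slope//; last by move=> u; rewrite lee_fin ker_ge0.
pose s (m : R) := Num.sqrt (1 + m ^+ 2).
have s2 m : s m ^+ 2 = 1 + m ^+ 2 by rewrite sqr_sqrtr// addr_ge0// sqr_ge0.
have s0 m : 0 < s m by rewrite sqrtr_gt0 ltr_pwDl// sqr_ge0.
have ms : measurable_fun [set: T] (s : T -> T).
  apply: (eq_measurable_fun (fun m : T => (1 + m ^+ 2) `^ 2^-1)).
    by move=> m _; rewrite powR12_sqrt// addr_ge0// sqr_ge0.
  apply: (measurableT_comp (@measurable_powR R 2^-1)).
  by apply: measurable_funD => //; exact: measurable_funX.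
pose H (u : T * T) := (((s u.2)^-1 * (1 + (s u.2 * u.1) ^+ 2)^-1)%:E : \bar R).
have mH : measurable_fun setT H.
  apply/measurable_EFinP; apply: measurable_funM.
    apply: (measurableT_comp measurable_inv); exact: measurableT_comp.
  apply: (measurableT_comp measurable_inv); apply: measurable_funD => //.
  by apply: measurable_funX; apply: measurable_funM => //; exact: measurableT_comp.
have H0 u : (0 <= H u)%E.
  by rewrite lee_fin mulr_ge0// invr_ge0 ?(ltW (s0 _))// addr_ge0// sqr_ge0.
rewrite (@eq_ge0_integral_fibre2 R _ H)//; first last.
- move=> x x0; apply: eq_integral => m _; rewrite -EFinM; congr EFin => /=.
  rewrite /ker.
  have -> : nrm (Complex x (x * m)) = s m * `|x|.
    rewrite /= (_ : x ^+ 2 + (x * m) ^+ 2 = (1 + m ^+ 2) * x ^+ 2); last by ring.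
    by rewrite sqrtrM ?addr_ge0 ?sqr_ge0// sqrtr_sqr.
  rewrite /pinv mulf_eq0 normr_eq0 (negbTE x0) orbF gt_eqF//.
  rewrite !exprMn real_normK ?num_real// invfM.
  by rewrite mulrAC mulfVK ?normr_eq0.
- by move=> u; rewrite mule_ge0// lee_fin ker_ge0.
- exact: (measurable_slope mker).
rewrite (fubini_tonelli1 _ mH H0) (fubini_tonelli _ mH H0).
pose P := (\int[mu]_x ((1 + x ^+ 2)^-1)%:E)%E.
have P0 : (0 <= P)%E.
  by apply: integral_ge0 => x _; rewrite lee_fin invr_ge0 addr_ge0// sqr_ge0.
have Pfin : P \is a fin_num by rewrite ge0_fin_numE// integral_oneDsqr_lty.
rewrite (_ : (fun _ => _) = (fun m : R => P * ((1 + m ^+ 2)^-1)%:E)%E); last first.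
  apply/funext => m; rewrite /P.
  rewrite -[in RHS](@ge0_integral_affine _ (s m) 0)//; last 3 first.
  - by rewrite gt_eqF.
  - apply/measurable_EFinP; apply: (measurableT_comp measurable_inv).
    by apply: measurable_funD => //; exact: measurable_funX.
  - by move=> x; rewrite lee_fin invr_ge0 addr_ge0// sqr_ge0.
  rewrite muleC -ge0_integralZl//.
  - apply: eq_integral => x _; rewrite /H/= addr0 -!EFinM; congr EFin.
    rewrite gtr0_norm// -s2; field.
    by rewrite !gt_eqF ?s0// ltr_pwDl// sqr_ge0.
  - apply: emeasurable_funM => //; apply/measurable_EFinP; apply: (measurableT_comp measurable_inv).
    apply: measurable_funD => //; apply: measurable_funX; apply: measurable_funD => //.
  - by move=> x _; rewrite mule_ge0// lee_fin// invr_ge0 addr_ge0// sqr_ge0.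
  - by rewrite lee_fin invr_ge0 addr_ge0// sqr_ge0.
rewrite ge0_integralZl//.
- by rewrite lte_mul_pinfty// integral_oneDsqr_lty.
- apply/measurable_EFinP; apply: (measurableT_comp measurable_inv).
  by apply: measurable_funD => //; exact: measurable_funX.
- by move=> x _; rewrite lee_fin invr_ge0 addr_ge0// sqr_ge0.
Qed.

Lemma cint_ker_add (w : C) : cint (fun z => (ker (z - w))%:E) = cint (fun z => (ker z)%:E).
Proof.
apply: (cint_add (F := fun z => (ker z)%:E)).
  by have := cmeas_ker 0; rewrite /cmeas; under eq_fun do rewrite addr0.
by move=> z; rewrite lee_fin ker_ge0.
Qed.

End dominating_kernel.

(** * Products of powers of distances *)

Section product_bound.
Local Open Scope ring_scope.
Context {R : realType} {r : nat}.
Variable k : 'I_r -> int.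
Local Notation C := R[i].
Local Notation nrm := (@Normc.normc R).
Hypothesis k_ge : forall i, -1 <= k i.
Hypothesis ksum : \sum_(i < r) k i = -4.

Lemma exprz_comparable (L s D : R) (n : int) : 1 <= L -> 0 < s -> s / L <= D -> D <= L * s ->
  D ^ n <= L ^+ `|n| * s ^ n.
Proof.
move=> L1 s0 sD Ds; have L0 : 0 < L by rewrite (lt_le_trans _ L1).
have D0 : 0 < D by rewrite (lt_le_trans _ sD)// divr_gt0.
case: n => n /=; first by rewrite -exprMn lerXn2r// nnegrE ltW// mulr_gt0.
rewrite /exprz -exprVn -exprVn -exprMn lerXn2r ?nnegrE ?invr_ge0 ?(ltW D0)//.
  by rewrite mulr_ge0 ?invr_ge0 ?ltW.
by rewrite -(invrK (L / s)) lef_pV2 ?posrE ?invr_gt0 ?divr_gt0// invf_div.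
Qed.

Lemma exprz_pinv (d : R) (n : int) : 0 <= d -> -1 <= n ->
  d ^ n <= pinv d * (1 + d) ^ (n + 1).
Proof.
move=> d0 n1; have -> : n = `|n + 1|%:Z - 1 by lia.
move: `|_|%N => {n n1}m; rewrite subrK /pinv.
case: eqVneq => [->|d1].
  by rewrite addr0 mul1r exp1rz exp0rz lern1; case: eqP.
rewrite expfzDr// -exprnP mulrC ler_wpM2l ?invr_ge0// exprnP lerXn2r ?nnegrE ?addr_ge0//.
by rewrite lerDr.
Qed.

Lemma nrm_sub (x y : C) : nrm (x - y) = nrm (y - x).
Proof. by rewrite -nrmN opprB. Qed.

Lemma ler_nrmD (x y : C) : nrm (x + y) <= nrm x + nrm y.
Proof. exact: le_normcD. Qed.

(** Let x i be the singularity closest to z. The distances to the others are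
    comparable to s = 1 + |z - x i|, so the product is comparable to
    |z - x i| ^ k i * s ^ (-4 - k i), which [ker] bounds as k i >= -1. The
    comparison constants depend only on the bound B and the separation e,
    which makes the estimate uniform near a configuration. *)
Lemma prod_nrm_bound (B e : R) : 0 < e -> 0 <= B -> exists2 M : R, 0 <= M &
  forall x : 'I_r -> C, (forall i, nrm (x i) <= B) ->
    (forall i j, i != j -> e <= nrm (x i - x j)) ->
    forall z, \prod_(i < r) nrm (z - x i) ^ k i <= M * \sum_(i < r) ker (z - x i).
Proof.
move=> e0 B0.
have r0 : (0 < r)%N.
  case: (posnP r) => // r0; move: ksum; rewrite big1// => i _.
  by have := ltn_ord i; rewrite [X in (_ < X)%N]r0.
pose c := Num.min 1 (e / 2).
have c0 : 0 < c by rewrite lt_min ltr01 divr_gt0.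
pose L := 1 + 2 * B + 2 / c.
have ic0 : 0 < 2 / c by exact: divr_gt0.
have L1 : 1 <= L by rewrite /L; lra.
have L0 : 0 < L by rewrite (lt_le_trans _ L1).
exists (\prod_(i < r) L ^+ `|k i|).
  by apply: prodr_ge0 => i _; rewrite exprn_ge0// ltW.
move=> x xB xe z.
case: (Order.TotalTheory.arg_minP (fun i => nrm (z - x i)) (i0 := Ordinal r0) (P := xpredT)) => // i _ imin.
set d := nrm (z - x i).
have d0 : 0 <= d by exact: nrm_ge0.
pose s := 1 + d.
have s0 : 0 < s by rewrite ltr_pwDl.
have Dj j : j != i -> s / L <= nrm (z - x j) /\ nrm (z - x j) <= L * s.
  move=> ji; set D := nrm (z - x j).
  have dD : d <= D by exact: imin.
  have eD : e <= d + D.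
    rewrite (le_trans (xe _ _ ji))// (_ : x j - x i = (z - x i) + (x j - z)); last by ring.
    by rewrite (le_trans (ler_nrmD _ _))// lerD2l nrm_sub.
  have Dd : D <= d + 2 * B.
    rewrite /D (_ : z - x j = (z - x i) + (x i - x j)); last by ring.
    rewrite (le_trans (ler_nrmD _ _))// lerD2l (le_trans (ler_nrmD _ _))// nrmN.
    by have := xB i; have := xB j; lra.
  have cD : c <= D by rewrite /c ge_min; apply/orP; right; lra.
  have c1 : c <= 1 by rewrite /c ge_min lexx.
  split; last first.
    have : 0 <= 2 / c * s by rewrite mulr_ge0 ?ltW// divr_gt0.
    have : 0 <= 2 * B * d by rewrite !mulr_ge0.
    rewrite /L /s; nra.
  rewrite ler_pdivrMr//.
  have : 2 <= D * (2 / c) by rewrite mulrCA ler_peMr// ler_pdivlMr// mul1r.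
  have : 0 <= D * (2 * B) by rewrite !mulr_ge0// nrm_ge0.
  have : d * 1 <= D * (2 / c) / 2 * 1.
    rewrite !mulr1 mulrA mulrAC mulfK ?pnatr_eq0// ler_pdivlMr//.
    by rewrite (le_trans _ dD)// ler_piMr.
  rewrite /L /s !mulrDr !mulr1; lra.
rewrite (bigD1 i)//= -/d.
apply: (@le_trans _ _ ((pinv d * s ^ (k i + 1)) *
    \prod_(j < r | j != i) (L ^+ `|k j| * s ^ k j))).
  apply: ler_pM; rewrite ?exprz_ge0//.
  - by apply: prodr_ge0 => j _; rewrite exprz_ge0// nrm_ge0.
  - exact: exprz_pinv.
  - apply: ler_prod => j ji; rewrite exprz_ge0 ?nrm_ge0//=.
    by have [] := Dj j ji; exact: exprz_comparable.
rewrite big_split/= mulrACA [pinv d * _]mulrC -mulrA.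
apply: ler_pM.
- by apply: prodr_ge0 => j _; rewrite exprn_ge0// ltW.
- by rewrite !mulr_ge0 ?pinv_ge0 ?exprz_ge0 ?(ltW s0)// prodr_ge0// => j _; rewrite exprz_ge0// ltW.
- rewrite [leRHS](bigD1 i)//= ler_peMl//; last exact: exprn_ege1.
  by apply: prodr_ge0 => j _; rewrite exprn_ge0// ltW.
apply: (@le_trans _ _ (ker (z - x i))); last first.
  by rewrite (bigD1 i)//= lerDl sumr_ge0// => j _; exact: ker_ge0.
rewrite /ker -/d ler_wpM2l ?pinv_ge0// expfzDr ?gt_eqF// expr1z mulrAC.
have -> : s ^ k i * (\prod_(j < r | j != i) s ^ k j) = s ^- 4.
  by rewrite -(prod_exprz ksum) ?gt_eqF// [RHS](bigD1 i).
have -> : s ^- 4 * s = (s ^+ 3)^-1 by field; rewrite gt_eqF.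
rewrite lef_pV2 ?posrE ?exprn_gt0 ?ltr_pwDl ?sqr_ge0//.
rewrite /s; nra.
Qed.

End product_bound.

(** * The area as a function of finite singularities *)

Lemma finite_pos_lbound (R : realFieldType) (T : finType) (P : pred T) (f : T -> R) :
  (forall t, P t -> 0 < f t)%R -> exists2 e : R, (0 < e)%R & forall t, P t -> (e <= f t)%R.
Proof.
move=> f0; exists ((1 + \sum_(t | P t) (f t)^-1)^-1)%R.
  by rewrite invr_gt0 ltr_pwDl// sumr_ge0// => t Pt; rewrite invr_ge0 ltW// f0.
move=> t Pt; rewrite -[leRHS]invrK lef_pV2 ?posrE ?invr_gt0 ?f0//.
  rewrite (bigD1 t)//= addrCA lerDl addr_ge0// sumr_ge0// => u /andP[Pu _].
  by rewrite invr_ge0 ltW// f0.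
by rewrite ltr_pwDl// sumr_ge0// => u Pu; rewrite invr_ge0 ltW// f0.
Qed.

Section area_of_points.
Local Open Scope classical_set_scope.
Local Open Scope ring_scope.
Context {R : realType} {r : nat}.
Variable k : 'I_r -> int.
Local Notation C := R[i].
Local Notation nrm := (@Normc.normc R).
Local Notation T := (measurableTypeR R).
Local Notation mu2 := ((@lebesgue_measure R \x @lebesgue_measure R)%E).
Hypothesis k_ge : forall i, -1 <= k i.
Hypothesis ksum : \sum_(i < r) k i = -4.
Implicit Types x y : 'I_r -> C.

Definition density x (z : C) : R := \prod_(i < r) nrm (z - x i) ^ k i.

Lemma density_ge0 x z : 0 <= density x z.
Proof. by apply: prodr_ge0 => i _; rewrite exprz_ge0// nrm_ge0. Qed.

Lemma cmeas_density x : cmeas (fun z => (density x z)%:E).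
Proof.
apply: (@cmeas_prod R r (fun i z => nrm (z - x i) ^ k i)) => i.
apply: (@cmeasXz R (fun z => nrm (z - x i))).
have -> : EFin \o (fun z : C => nrm (z - x i)) = fun z => (nrm (1 * z + - x i))%:E.
  by apply/funext => z /=; rewrite mul1r.
exact: cmeas_nrm.
Qed.

Definition points_area x := cint (fun z => (density x z)%:E).

Lemma negligible_point (p : C) : {ae mu2, forall u : T * T, Complex u.1 u.2 != p}.
Proof.
exists ([set complex.Re p] `*` [set complex.Im p]); split.
- by apply: measurableX; exact: measurable_set1.
- rewrite product_measure1E//; try exact: measurable_set1.
  by rewrite [X in (X * _)%E](lebesgue_measure_set1 (complex.Re p)) mul0e.
- by case=> a b /= /negP; rewrite negbK => /eqP <-.
Qed.

Lemma negligible_points x : {ae mu2, forall u : T * T, forall i, Complex u.1 u.2 != x i}.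
Proof.
have : forall i, {ae mu2, forall u : T * T, Complex u.1 u.2 != x i} by move=> i; exact: negligible_point.
move/filter_forall; apply: filterS => u h i; exact: h.
Qed.

Lemma cvg_nrm_sub (x : nat -> C) (y z : C) : nrm (x n - y) @[n --> \oo] --> 0 ->
  nrm (z - x n) @[n --> \oo] --> nrm (z - y).
Proof.
move=> xy; apply/cvgrPdist_lt => e e0.
have /cvgrPdist_lt/(_ e e0) := xy; apply: filterS => n.
rewrite sub0r normrN ger0_norm ?nrm_ge0// => lt.
apply: le_lt_trans lt; rewrite ler_distl; apply/andP; split.
  rewrite lerBlDr (_ : z - x n = (z - y) + - (x n - y)); last by ring.
  by rewrite (le_trans (ler_nrmD _ _))// nrmN.
rewrite (_ : z - y = (z - x n) + (x n - y)); last by ring.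
exact: ler_nrmD.
Qed.

Lemma cvg_exprz (u : nat -> R) (l : R) (n : int) : l != 0 -> u @ \oo --> l ->
  u m ^ n @[m --> \oo] --> l ^ n.
Proof.
move=> l0 ul; case: n => n; first exact: (cvg_comp _ _ ul (@exprn_continuous _ n l)).
apply: cvgV; first by rewrite expf_neq0.
exact: (cvg_comp _ _ ul (@exprn_continuous _ n.+1 l)).
Qed.

Lemma cvg_prodr (I : Type) (s : seq I) (u : nat -> I -> R) (l : I -> R) :
  (forall i, u ^~ i @ \oo --> l i) -> \prod_(i <- s) u n i @[n --> \oo] --> \prod_(i <- s) l i.
Proof.
move=> ul; elim: s => [|i s IHs].
  by under eq_fun do rewrite big_nil; rewrite big_nil; exact: cvg_cst.
by under eq_fun do rewrite big_cons; rewrite big_cons; apply: cvgM.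
Qed.

Lemma cvg_sumr (I : Type) (s : seq I) (u : nat -> I -> R) (l : I -> R) :
  (forall i, u ^~ i @ \oo --> l i) -> \sum_(i <- s) u n i @[n --> \oo] --> \sum_(i <- s) l i.
Proof.
move=> ul; elim: s => [|i s IHs].
  by under eq_fun do rewrite big_nil; rewrite big_nil; exact: cvg_cst.
by under eq_fun do rewrite big_cons; rewrite big_cons; apply: cvgD.
Qed.

Lemma cvg_density (x : nat -> 'I_r -> C) y (z : C) : (forall i, z != y i) ->
  (forall i, nrm (x n i - y i) @[n --> \oo] --> 0) ->
  density (x n) z @[n --> \oo] --> density y z.
Proof.
move=> zy xy; apply: cvg_prodr => i; apply: cvg_exprz; last exact: cvg_nrm_sub.
by rewrite nrm_eq0 subr_eq0.
Qed.

Lemma cvg_ker (x : nat -> C) (y z : C) : z != y ->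
  nrm (x n - y) @[n --> \oo] --> 0 -> ker (z - x n) @[n --> \oo] --> ker (z - y).
Proof.
move=> zy xy; have zxy := @cvg_nrm_sub x y z xy.
have n0 : nrm (z - y) != 0 by rewrite nrm_eq0 subr_eq0.
apply: cvgM.
- rewrite /pinv (negbTE n0); apply: cvg_trans (cvgV n0 zxy).
  apply: near_eq_cvg; near=> n; rewrite ifF//; apply/negbTE.
  rewrite gt_eqF//; near: n.
  apply: (cvgr_gt _ zxy); by rewrite lt_def n0 nrm_ge0.
- apply: cvgV; first by rewrite gt_eqF// ltr_pwDl// sqr_ge0.
  apply: cvgD; first exact: cvg_cst.
  exact: (cvg_comp _ _ zxy (@exprn_continuous _ 2 _)).
Unshelve. all: by end_near. Qed.

Lemma cint_sum_ker (M : R) x : 0 <= M ->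
  cint (fun z => (M * \sum_(i < r) ker (z - x i))%:E) =
  (M%:E * (\sum_(i < r) cint (fun z => (ker z)%:E)))%E.
Proof.
move=> M0; rewrite /cint.
under eq_integral do rewrite EFinM -sumEFin.
rewrite ge0_integralZl//; last 2 first.
- by apply: emeasurable_sum => i; exact: cmeas_ker.
- by move=> u _; apply: sume_ge0 => i _; rewrite lee_fin ker_ge0.
rewrite ge0_integral_sum//; last 2 first.
- by move=> i; exact: cmeas_ker.
- by move=> i u _; rewrite lee_fin ker_ge0.
by congr (_ * _)%E; apply: eq_bigr => i _; exact: cint_ker_add.
Qed.

Lemma sum_ker_lty (M : R) : (M%:E * (\sum_(i < r) cint (fun z : C => (ker z)%:E)) < +oo)%E.
Proof.
have kf : cint (fun z : C => (ker z)%:E) \is a fin_num.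
  by rewrite ge0_fin_numE ?cint_ker_lty// integral_ge0// => u _; rewrite lee_fin ker_ge0.
by rewrite -(fineK kf) sumEFin -EFinM ltry.
Qed.

Lemma separated_bounds y : (forall i j, i != j -> y i != y j) ->
  exists2 e, 0 < e & forall i j, i != j -> e <= nrm (y i - y j).
Proof.
move=> yd.
have [e e0 eP] := @finite_pos_lbound R ('I_r * 'I_r)%type (fun ij => ij.1 != ij.2)
  (fun ij => nrm (y ij.1 - y ij.2)) (fun ij h => ltac:(by rewrite nrm_gt0 subr_eq0; apply: yd)).
by exists e => // i j ij; exact: (eP (i, j)).
Qed.

Lemma upper_bounds y : exists2 B, 0 <= B & forall i, nrm (y i) <= B.
Proof.
exists (\sum_(i < r) nrm (y i)); first by apply: sumr_ge0 => i _; exact: nrm_ge0.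
by move=> i; rewrite (bigD1 i)//= lerDl sumr_ge0// => j _; exact: nrm_ge0.
Qed.

Lemma cmeas_sum_ker (M : R) x : cmeas (fun z => (M * \sum_(i < r) ker (z - x i))%:E).
Proof.
apply/measurable_EFinP; apply: measurable_funM => //.
apply: measurable_sum => i; apply/measurable_EFinP; exact: cmeas_ker.
Qed.

Lemma points_area_lty y : (forall i j, i != j -> y i != y j) -> (points_area y < +oo)%E.
Proof.
move=> yd; have [e e0 ye] := separated_bounds yd; have [B B0 yB] := upper_bounds y.
have [M M0 MP] := prod_nrm_bound k_ge ksum e0 B0.
apply: le_lt_trans (sum_ker_lty M); rewrite -(cint_sum_ker y M0).
apply: ge0_le_integral => //.
- by move=> u _; rewrite lee_fin density_ge0.
- exact: cmeas_density.
- exact: cmeas_sum_ker.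
- by move=> u _; rewrite lee_fin; exact: MP.
Qed.

(** The density only vanishes at the singularities. *)
Lemma points_area_gt0 y : (0 < points_area y)%E.
Proof.
rewrite lt0e; apply/andP; split; last by apply: integral_ge0 => u _; rewrite lee_fin density_ge0.
apply/eqP => A0.
have : ae_eq mu2 setT (fun u => (density y (Complex u.1 u.2))%:E) (cst 0%E).
  apply/ae_eq_integral_abs => //; first exact: cmeas_density.
  rewrite -[RHS]A0; apply: eq_integral => u _.
  by rewrite gee0_abs// lee_fin density_ge0.
move=> D0; have [N [mN N0 NP]] : {ae mu2, forall u : T * T, False}.
  apply: filterS2 D0 (negligible_points y) => u /(_ I) [/eqP] /[swap] uy; apply/negP.
  by apply/prodf_neq0 => i _; rewrite expfz_neq0// nrm_eq0 subr_eq0.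
have mI : measurable (`[0, 1]%classic : set T) by [].
have : mu2 ((`[0, 1]%classic : set T) `*` (`[0, 1]%classic : set T)) = 0%E.
  apply/eqP; rewrite eq_le measure_ge0 andbT -N0 le_measure ?inE//.
    exact: measurableX.
  by move=> u _; exact: NP.
have mu01 : lebesgue_measure (`[0%R, 1%R]%classic : set R) = 1%:E.
  by rewrite lebesgue_measure_itv/= lte_fin ltr01 oppr0 adde0.
rewrite product_measure1E// [X in (X * _)%E]mu01 [X in (_ * X)%E]mu01 mule1.
by move=> /eqP; rewrite eqe oner_eq0.
Qed.

(** The bound of [prod_nrm_bound] is uniform near y, and its integral does not
    change with the centres of the kernels, by translation invariance. *)
Lemma cvg_points_area (x : nat -> 'I_r -> C) y : (forall i j, i != j -> y i != y j) ->
  (forall i, nrm (x n i - y i) @[n --> \oo] --> 0) ->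
  points_area (x n) @[n --> \oo] --> points_area y.
Proof.
move=> yd xy; have [e e0 ye] := separated_bounds yd; have [B B0 yB] := upper_bounds y.
have e20 : 0 < e / 2 by exact: divr_gt0.
have B10 : 0 <= B + 1 by exact: addr_ge0.
have [M M0 MP] := prod_nrm_bound k_ge ksum e20 B10.
pose d := Num.min 1 (e / 4).
have d0 : 0 < d by rewrite lt_min ltr01 divr_gt0.
have : \forall n \near \oo, forall i, nrm (x n i - y i) < d.
  apply: filter_forall => i; have /cvgrPdist_lt/(_ d d0) := xy i; apply: filterS => n.
  by rewrite sub0r normrN ger0_norm ?nrm_ge0.
move=> [N _ NP].
have MN n z : density (x (n + N)%N) z <= M * \sum_(i < r) ker (z - x (n + N)%N i).
  have {}NP i : nrm (x (n + N)%N i - y i) < d by apply: NP => /=; exact: leq_addl.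
  apply: MP => [i|i j ij].
  - rewrite (_ : x _ i = y i + (x (n + N)%N i - y i)); last by ring.
    rewrite (le_trans (ler_nrmD _ _))// lerD// ltW// (lt_le_trans (NP i))//.
    by rewrite /d ge_min lexx.
  - have d4 : d <= e / 4 by rewrite /d ge_min lexx orbT.
    have := ye i j ij; rewrite (_ : y i - y j = (x (n + N)%N i - x (n + N)%N j) +
      (- (x (n + N)%N i - y i) + (x (n + N)%N j - y j))); last by ring.
    move=> h; have := le_trans h (ler_nrmD _ _).
    have := ler_nrmD (- (x (n + N)%N i - y i)) (x (n + N)%N j - y j).
    rewrite nrmN; have := NP i; have := NP j; lra.
have xNy i : nrm (x (n + N)%N i - y i) @[n --> \oo] --> 0.
  by have := xy i; rewrite -(cvg_shiftn N).
rewrite -(cvg_shiftn N).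
apply: (@cvg_integral_moving_dominated _ _ R mu2
  (fun n (u : T * T) => density (x (n + N)%N) (Complex u.1 u.2))
  (fun n (u : T * T) => M * \sum_(i < r) ker (Complex u.1 u.2 - x (n + N)%N i))
  (fun u : T * T => density y (Complex u.1 u.2))
  (fun u : T * T => M * \sum_(i < r) ker (Complex u.1 u.2 - y i))).
- by move=> n; apply/measurable_EFinP; exact: cmeas_density.
- by apply/measurable_EFinP; exact: cmeas_density.
- by move=> n; apply/measurable_EFinP; exact: cmeas_sum_ker.
- by apply/measurable_EFinP; exact: cmeas_sum_ker.
- by move=> n u; exact: density_ge0.
- by move=> n u; rewrite mulr_ge0// sumr_ge0// => i _; exact: ker_ge0.
- by move=> u; rewrite mulr_ge0// sumr_ge0// => i _; exact: ker_ge0.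
- by apply: filterS (negligible_points y) => u uy; exact: cvg_density.
- apply: filterS (negligible_points y) => u uy; apply: cvgM; first exact: cvg_cst.
  by apply: cvg_sumr => i; exact: cvg_ker.
- by move=> n u; exact: MN.
- by have := sum_ker_lty M; rewrite -(cint_sum_ker y).
- by move=> n; have := cint_sum_ker y M0; rewrite -(cint_sum_ker (x (n + N)%N)) => // ->.
Qed.

End area_of_points.

(** * Convergence in matrix and complex spaces *)

Lemma gt0_complexE (R : realType) (e : R[i]) : (0 < e)%R -> e = (complex.Re e)%:C%C /\ (0 < complex.Re e)%R.
Proof. by case: e => a b; rewrite ltcE/= => /andP[/eqP -> a0]. Qed.

Section topology_helpers.
Local Open Scope classical_set_scope.
Local Open Scope ring_scope.

Lemma cvg_mx (T : topologicalType) (F : set_system T) m n (V : topologicalType) (f : T -> 'M[V]_(m, n))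
   (M : 'M[V]_(m, n)) : Filter F ->
  (forall i j, f x i j @[x --> F] --> M i j) -> f @ F --> M.
Proof.
move=> FF fM A [P MP PA].
have : \forall x \near F, forall i, forall j, P i j (f x i j).
  by apply: filter_forall => i; apply: filter_forall => j; apply: fM; exact: MP.
by apply: filterS => x Px; exact: PA.
Qed.

Lemma continuous_mx_entry (V : topologicalType) m n (i : 'I_m) (j : 'I_n) :
  continuous (fun M : 'M[V]_(m, n) => M i j).
Proof.
move=> M A MA; exists (fun i' j' => [set x | i' = i -> j' = j -> A x]).
  move=> i' j'; have [[-> ->]|ne] := pselect (i' = i /\ j' = j).
    by apply: filterS MA => x Ax _ _.
  by apply: filterS filterT => x _ /= ei ej; case: ne.
by move=> N PN; exact: PN.
Qed.

(** Positive elements of R[i] are positive reals, so balls of radii 1 / n form a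
    basis. Theorems on integrals are about sequences, continuity is not. *)
Lemma cvg_seq (R : realType) (X : pseudoMetricType R[i]) (Y : topologicalType) (f : X -> Y) (a : X) (l : Y) :
  (forall u : nat -> X, u @ \oo --> a -> f (u n) @[n --> \oo] --> l) -> f @ a --> l.
Proof.
move=> H V Vl; apply: contrapT => nV.
have inv0 n : 0 < (n.+1%:R^-1)%:C%C :> R[i] by rewrite ltcR invr_gt0 ltr0n.
have : forall n, exists x, ball a ((n.+1%:R^-1)%:C%C : R[i]) x /\ ~ V (f x).
  move=> n; apply: contrapT => /forallNP h; apply: nV.
  apply/nbhs_ballP; exists ((n.+1%:R^-1)%:C%C) => //= x ax.
  by apply: contrapT => Vx; exact: (h x).
move=> /choice[u uP].
have ua : u @ \oo --> a.
  apply/cvg_ballP => e /gt0_complexE[-> e0].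
  near=> n; apply: (@le_ball _ _ _ ((n.+1%:R^-1)%:C%C)); last by have [] := uP n.
  by rewrite lecR ltW//; near: n; exact: near_infty_natSinv_lt (PosNum e0).
have [N _ NP] := H u ua V Vl.
by have [_] := uP N; apply; apply: NP => /=.
Unshelve. all: by end_near. Qed.

Lemma cvg_complex_nrm (R : realType) (T : Type) (F : set_system T) (u : T -> R[i]) (l : R[i]) :
  Filter F -> u @ F --> l -> Normc.normc (u n - l) @[n --> F] --> (0 : R).
Proof.
move=> FF ul; apply/cvgrPdist_lt => e e0.
have e0' : 0 < (e%:C)%C by rewrite ltcR.
have /cvgrPdist_lt/(_ _ e0') := ul.
apply: filterS => n; rewrite normc_def ltcR sub0r normrN ger0_norm ?nrm_ge0//.
by rewrite nrm_sub; case: (l - u n).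
Qed.

End topology_helpers.

(** * The area of regular data *)

Section area_continuity.
Local Open Scope classical_set_scope.
Local Open Scope ring_scope.
Context {R : realType} {r : nat}.
Variable k : 'I_r -> int.
Local Notation C := R[i].
Local Notation nrm := (@Normc.normc R).
Local Notation X := (C * 'M[C]_(r, 2))%type.
Hypothesis k_ge : forall i, -1 <= k i.
Hypothesis ksum : \sum_(i < r) k i = -4.

(** The conditions on a quadratic differential other than the one on squares,
    which they imply. *)
Definition regular : set X := [set a |
  [/\ a.1 != 0, forall i, sing a i != 0 &
      forall i j, i != j -> wedge (sing a i) (sing a j) != 0]].

Lemma wedge_affine (z : C) (s : 'rV[C]_2) : s ord0 ord_max != 0 ->
  wedge (affine z) s = s ord0 ord_max * (z - s ord0 ord0 / s ord0 ord_max).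
Proof. by move=> s1; rewrite /wedge !mxE/=; field. Qed.

Lemma continuous_coef : continuous (fun a : X => a.1).
Proof. by move=> a; exact: cvg_fst. Qed.

Lemma continuous_entry (i : 'I_r) (j : 'I_2) : continuous (fun a : X => sing a i ord0 j : C).
Proof.
have -> : (fun a : X => sing a i ord0 j : C) = (fun a => a.2 i j).
  by apply/funext => b; rewrite mxE.
move=> a; exact: (cvg_comp (fun a : X => a.2) (fun M : 'M[C]_(r, 2) => M i j)
  cvg_snd (@continuous_mx_entry C r 2 i j a.2)).
Qed.

Lemma continuous_wedge (i j : 'I_r) : continuous (fun a : X => wedge (sing a i) (sing a j) : C).
Proof.
by move=> a; apply: cvgB; apply: cvgM; exact: continuous_entry.
Qed.

Let pt (a : X) (i : 'I_r) : C := sing a i ord0 ord0 / sing a i ord0 ord_max.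
Let lead (a : X) : R := nrm a.1 * \prod_(i < r) nrm (sing a i ord0 ord_max) ^ k i.
Let finite_sing (a : X) := forall i, sing a i ord0 ord_max != 0.

Let flat_area_finite a : finite_sing a ->
  flat_area k a = ((lead a)%:E * points_area k (pt a))%E.
Proof.
move=> fa; rewrite flat_areaE /points_area /cint -ge0_integralZl//.
- apply: eq_integral => u _; rewrite -EFinM nrm_qcoef -mulrA -big_split/=.
  congr (_ * _)%:E; apply: eq_bigr => i _; rewrite -expfzMl -Normc.normcM.
  by rewrite wedge_affine.
- exact: cmeas_density.
- by move=> u _; rewrite lee_fin density_ge0.
- by rewrite lee_fin mulr_ge0 ?nrm_ge0// prodr_ge0// => i _; rewrite exprz_ge0 ?nrm_ge0.
Qed.

Let pt_neq a : regular a -> finite_sing a -> forall i j, i != j -> pt a i != pt a j.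
Proof.
move=> [_ _ wa] fa i j ij; apply: contra (wa i j ij) => /eqP.
rewrite /pt /wedge => /eqP; rewrite eqr_div// => /eqP e.
by rewrite subr_eq0 e mulrC.
Qed.

Let lead_gt0 a : regular a -> finite_sing a -> 0 < lead a.
Proof.
move=> [a0 _ _] fa; rewrite mulr_gt0 ?nrm_gt0// prodr_gt0// => i _.
by rewrite exprz_gt0// nrm_gt0.
Qed.

Let cvg_area_finite a : regular a -> finite_sing a -> flat_area k @ a --> flat_area k a.
Proof.
move=> ra fa; apply: cvg_seq => u ua.
have ucoef : (u n).1 @[n --> \oo] --> a.1 by apply: (cvg_comp _ _ ua); exact: continuous_coef.
have uent i j : sing (u n) i ord0 j @[n --> \oo] --> (sing a i ord0 j : C).
  exact: (cvg_comp u (fun a : X => sing a i ord0 j : C) ua (@continuous_entry i j a)).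
have unrm (v : nat -> C) (l : C) : v @ \oo --> l -> nrm (v n) @[n --> \oo] --> nrm l.
  move=> /cvg_complex_nrm => /(_ _) vl.
  have := @cvg_nrm_sub R v l 0 vl.
  by under eq_fun do rewrite sub0r nrmN; rewrite sub0r nrmN.
rewrite (flat_area_finite fa).
suff H : ((lead (u n))%:E * points_area k (pt (u n)))%E @[n --> \oo] -->
    ((lead a)%:E * points_area k (pt a))%E.
  apply: cvg_trans H; apply: near_eq_cvg; near=> n; apply/esym/flat_area_finite; near: n.
  apply: filter_forall => i.
  have := unrm _ _ (uent i ord_max) => /cvgr_gt /(_ 0); rewrite nrm_gt0 fa => /(_ isT).
  by apply: filterS => n; rewrite nrm_gt0.
apply: cvgeM.
- rewrite mule_def_fin// ge0_fin_numE ?(ltW (points_area_gt0 _ _))//.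
  exact: points_area_lty k_ge ksum _ (pt_neq ra fa).
- apply: cvg_EFin; first exact: nearW.
  apply: cvgM; first exact: unrm.
  apply: (@cvg_prodr R _ _ (fun n i => nrm (sing (u n) i ord0 ord_max) ^ k i)) => i.
  have li0 : nrm (sing a i ord0 ord_max) != 0 by rewrite nrm_eq0.
  have H := unrm _ _ (uent i ord_max).
  exact: (cvg_exprz li0 H).
- apply: cvg_points_area => //; first exact: pt_neq.
  move=> i; apply: cvg_complex_nrm; apply: cvgM; first exact: uent.
  by apply: cvgV; [exact: fa|exact: uent].
Unshelve. all: by end_near. Qed.

Lemma moebius_regular g (l : 'I_r -> C) a : g \in unitmx -> (forall i, l i != 0) ->
  regular a -> regular (moebius k g l a).
Proof.
move=> gu l0 [a0 sa wa]; have d0 : \det g != 0 by move: gu; rewrite unitmxE unitfE.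
split=> [|i|i j ij]; first last.
- by rewrite !sing_moebius wedgeZl wedgeZr wedge_mulmx !mulf_neq0// wa.
- rewrite sing_moebius scaler_eq0 negb_or l0/=; apply: contra (sa i) => /eqP s0.
  by rewrite -[sing a i](mulmxK gu) s0 mul0mx.
- rewrite !mulf_neq0//.
  by apply/prodf_neq0 => i _; rewrite expfz_neq0.
Qed.

Lemma row_mulE2 (s : 'rV[C]_2) (g : 'M[C]_2) i j :
  (s *m g) i j = s ord0 ord0 * g ord0 j + s ord0 ord_max * g ord_max j.
Proof.
rewrite mxE !big_ord_recl big_ord0 addr0 (ord1 i).
by have -> : lift ord0 ord0 = ord_max :> 'I_2 by exact: val_inj.
Qed.

Lemma row2P (s t : 'rV[C]_2) :
  s ord0 ord0 = t ord0 ord0 -> s ord0 ord_max = t ord0 ord_max -> s = t.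
Proof.
move=> e0 e1; apply/rowP => j; have [->|j0] := eqVneq j ord0; first exact: e0.
by have -> : j = ord_max by apply: val_inj; case: j j0 => -[|[|]].
Qed.

Lemma continuous_moebius g (l : 'I_r -> C) : continuous (moebius k g l).
Proof.
move=> a.
have h1 : (b.1 * \det g ^+ 2 * \prod_(i < r) l i ^ (- k i) : C) @[b --> a] -->
    a.1 * \det g ^+ 2 * \prod_(i < r) l i ^ (- k i).
  apply: cvgM; last exact: cvg_cst.
  by apply: cvgM; [exact: continuous_coef|exact: cvg_cst].
have h2 : (moebius k g l b).2 @[b --> a] --> (moebius k g l a).2.
  apply: cvg_mx => i j.
  have -> : (fun b : X => (moebius k g l b).2 i j : C) = (fun b =>
      l i * (sing b i ord0 ord0 * g ord0 j + sing b i ord0 ord_max * g ord_max j)).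
    by apply/funext => b; rewrite mxE mxE row_mulE2.
  rewrite mxE mxE row_mulE2; apply: cvgM; first exact: cvg_cst.
  by apply: cvgD; apply: cvgM; [exact: continuous_entry|exact: cvg_cst|
    exact: continuous_entry|exact: cvg_cst].
exact: (cvg_pair h1 h2).
Qed.

(** The matrix g sends (x, y) to (y, x + t y), and t avoids the finitely many
    values - x / y. *)
Lemma exists_finite_chart (a : X) : (forall i, sing a i != 0) ->
  exists2 g : 'M[C]_2, g \in unitmx & forall i, (sing a i *m g) ord0 ord_max != 0.
Proof.
move=> sa.
(* larger in modulus than all the affine coordinates *)
pose t : C := (1 + \sum_(i < r) nrm (sing a i ord0 ord0 / sing a i ord0 ord_max))%:C%C.
have tP i : sing a i ord0 ord_max != 0 -> t != - (sing a i ord0 ord0 / sing a i ord0 ord_max).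
  move=> s1; apply/eqP => tE.
  have : nrm t = nrm (sing a i ord0 ord0 / sing a i ord0 ord_max) by rewrite tE nrmN.
  rewrite /t /= expr0n/= addr0 sqrtr_sqr ger0_norm; last first.
    by rewrite addr_ge0// sumr_ge0// => j _; exact: nrm_ge0.
  rewrite (bigD1 i)//= addrCA => /eqP; rewrite -subr_eq0 addrAC subrr add0r.
  by apply/negP; rewrite gt_eqF// ltr_pwDl// sumr_ge0// => j _; exact: nrm_ge0.
pose g : 'M[C]_2 := \matrix_(i, j) if i == ord0 then (j == ord_max)%:R else
  if j == ord0 then 1 else t.
exists g.
  by rewrite unitmxE unitfE det2 !mxE/= mul0r mul1r sub0r oppr_eq0 oner_neq0.
move=> i; rewrite row_mulE2 [g _ _]mxE [g _ _]mxE/= mulr1.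
have [s1|s1] := eqVneq (sing a i ord0 ord_max) 0.
  rewrite s1 mul0r addr0; apply: contra (sa i) => /eqP s0; apply/eqP/row2P.
    by rewrite s0 mxE.
  by rewrite s1 mxE.
apply: contra (tP i s1) => /eqP e; apply/eqP; apply: (mulfI s1).
by rewrite mulrN mulrCA mulfV// mulr1; apply/eqP; rewrite -addr_eq0 addrC e.
Qed.

(** A fixed Moebius map, which preserves the area, moves all the singularities
    near [a] away from infinity, where the area is [points_area] up to a factor. *)
Lemma flat_area_regular a : regular a ->
  [/\ (0 < flat_area k a)%E, (flat_area k a < +oo)%E & flat_area k @ a --> flat_area k a].
Proof.
move=> ra; have [g gu gP] : exists2 g : 'M[C]_2, g \in unitmx & forall i, (sing a i *m g) ord0 ord_max != 0.
  by apply: exists_finite_chart; have [] := ra.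
pose m := moebius k g (fun=> 1).
have one0 (i : 'I_r) : (1 : C) != 0 by exact: oner_neq0.
have mE b : flat_area k b = flat_area k (m b).
  exact: (flat_area_isomorphic ksum (isomorphic_moebius ksum b gu one0)).
have rm : regular (m a) by exact: moebius_regular.
have fm : finite_sing (m a) by move=> i; rewrite sing_moebius scale1r.
split.
- by rewrite mE flat_area_finite// mule_gt0 ?lte_fin ?lead_gt0 ?points_area_gt0.
- rewrite mE flat_area_finite// lte_mul_pinfty ?lee_fin ?(ltW (lead_gt0 _ _))//.
  exact: points_area_lty k_ge ksum _ (pt_neq rm fm).
rewrite (_ : flat_area k = flat_area k \o m); last exact/funext.
apply: continuous_comp; first exact: continuous_moebius.
exact: cvg_area_finite.
Qed.

End area_continuity.

(** * Quadratic differentials with a simple pole *)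

Section not_square.
Local Open Scope ring_scope.

Lemma poly0_of_horner (K : numFieldType) (p : {poly K}) : (forall z, p.[z] = 0) -> p = 0.
Proof.
move=> p0; apply/eqP; apply: contraT => pn0.
have := @max_poly_roots _ p [seq n%:R | n <- iota 0 (size p)] pn0.
rewrite size_map size_iota ltnn; apply.
  by apply/allP => z _; rewrite rootE p0.
by rewrite map_inj_uniq ?iota_uniq// => m n /eqP; rewrite eqr_nat => /eqP.
Qed.

Context {R : realType} {r : nat}.
Variable k : 'I_r -> int.
Local Notation C := R[i].
Local Notation X := (C * 'M[C]_(r, 2))%type.
Hypothesis k_ge : forall i, -1 <= k i.
Hypothesis ksum : \sum_(i < r) k i = -4.

(** Otherwise the orders would sum to at least k j >= -1. *)
Lemma exists_pole (j : 'I_r) : exists2 i, i != j & k i = -1.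
Proof.
apply: contrapT => h.
have kj i : i != j -> 0 <= k i.
  move=> ij; have := k_ge i; rewrite le_eqVlt => /predU1P[ki|]; last by lia.
  by case: h; exists i.
have := ksum; rewrite (bigD1 j)//=.
have : 0 <= \sum_(i < r | i != j) k i by apply: sumr_ge0.
by move: (\sum_(i < r | i != j) k i) (k_ge j) => S; lia.
Qed.

Lemma r_ge4 : (4 <= r)%N.
Proof.
have : \sum_(i < r) (-1 : int) <= \sum_(i < r) k i by apply: ler_sum => i _; exact: k_ge.
rewrite ksum sumr_const card_ord; lia.
Qed.

(** Clearing denominators in F = (f / g) ^ 2 gives f ^ 2 P ^ 2 = g ^ 2 Q, where P is
    the product of the linear factors of the singularities and Q has their
    powers k m + 2. A simple pole has multiplicity 1 in Q, so odd multiplicity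
    on the right and even on the left. There are two simple poles at least,
    hence one in the affine chart. *)
Lemma not_square (a : X) : regular a -> ~ is_square k a.
Proof.
move=> [a0 sa wa] [f [g [g0 fg]]].
have [i ki s1] : exists2 i, k i = -1 & sing a i ord0 ord_max != 0.
  have i0 : 'I_r by exact: (Ordinal (leq_trans (isT : (0 < 4)%N) r_ge4)).
  have [i _ ki] := exists_pole i0.
  have [si|si] := eqVneq (sing a i ord0 ord_max) 0; last by exists i.
  have [j ji kj] := exists_pole i; exists j => //.
  apply: contra (wa j i ji) => /eqP sj.
  by rewrite /wedge si sj mulr0 mul0r subrr.
pose W m : {poly C} := sing a m ord0 ord_max *: 'X - (sing a m ord0 ord0)%:P.
have WE m z : (W m).[z] = wedge (affine z) (sing a m).
  by rewrite !hornerE /wedge !mxE/= mul1r mulrC.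
have W0 m : W m != 0.
  apply: contra (sa m) => /eqP Wm; apply/eqP/row2P; rewrite [RHS]mxE.
    by have := congr1 (fun p : {poly C} => - p`_0) Wm; rewrite /W !coefE/= mulr0 sub0r opprK oppr0.
  by have := congr1 (fun p : {poly C} => p`_1) Wm; rewrite /W !coefE/= mulr1 subr0.
pose P : {poly C} := \prod_(m < r) W m.
have P0 : P != 0 by apply/prodf_neq0 => m _.
pose e m : nat := absz (k m + 2).
have eE m : k m = (e m)%:Z - 2 by rewrite /e; have := k_ge m; lia.
pose Q : {poly C} := a.1 *: \prod_(m < r) W m ^+ e m.
have key : f ^+ 2 * P ^+ 2 = g ^+ 2 * Q.
  apply/eqP; rewrite -subr_eq0; apply/eqP.
  have gP0 : g * P != 0 by rewrite mulf_neq0.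
  apply: (mulfI gP0); rewrite mulr0; apply: poly0_of_horner => z.
  rewrite hornerM [(g * P).[z]]hornerM.
  have [->|gz] := eqVneq g.[z] 0; first by rewrite !mul0r.
  have [->|Pz] := eqVneq P.[z] 0; first by rewrite mulr0 mul0r.
  suff -> : (f ^+ 2 * P ^+ 2 - g ^+ 2 * Q).[z] = 0 by rewrite mulr0.
  have Wz m : wedge (affine z) (sing a m) != 0.
    by rewrite -WE; move: Pz; rewrite horner_prod => /prodf_neq0; exact.
  have := fg z gz; rewrite /qcoef => E.
  have PE : P.[z] = \prod_(m < r) wedge (affine z) (sing a m).
    by rewrite horner_prod; apply: eq_bigr => m _; exact: WE.
  have QE : Q.[z] = a.1 * \prod_(m < r) wedge (affine z) (sing a m) ^+ e m.
    rewrite hornerZ horner_prod; congr (_ * _); apply: eq_bigr => m _.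
    by rewrite horner_exp WE.
  have -> : (f ^+ 2 * P ^+ 2 - g ^+ 2 * Q).[z] = f.[z] ^+ 2 * P.[z] ^+ 2 - g.[z] ^+ 2 * Q.[z].
    by rewrite !expr2 hornerD hornerN !hornerM.
  have -> : f.[z] = (f.[z] / g.[z]) * g.[z] by rewrite divfK.
  rewrite exprMn -E PE QE -prodrXl [_ * g.[z] ^+ 2]mulrC -!mulrA -big_split/=.
  rewrite (_ : \prod_(m < r) _ = \prod_(m < r) wedge (affine z) (sing a m) ^+ e m) ?subrr//.
  apply: eq_bigr => m _; rewrite -[_ ^+ 2]/(_ ^ 2%:Z) -[_ ^+ e m]/(_ ^ (e m)%:Z).
  by rewrite eE -expfzDr// subrK.
pose z0 := sing a i ord0 ord0 / sing a i ord0 ord_max.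
have Wi : W i = (sing a i ord0 ord_max)%:P * ('X - z0%:P) ^+ 1.
  by rewrite expr1 mulrBr -polyCM /z0 [_ * (_ / _)]mulrC divfK// mul_polyC.
have si : sing a i = sing a i ord0 ord_max *: affine z0.
  have a0E : affine z0 ord0 ord0 = z0 by rewrite mxE.
  have a1E : affine z0 ord0 ord_max = 1 by rewrite mxE.
  by apply/row2P; rewrite [RHS]mxE ?a0E ?a1E ?mulr1// mulrC divfK.
have Wm m : m != i -> ~~ root (W m ^+ e m) z0.
  move=> mi; rewrite rootE horner_exp expf_neq0// WE.
  have := wa i m; rewrite eq_sym mi {1}si wedgeZl => /(_ isT).
  by rewrite mulf_eq0 negb_or => /andP[].
have Q0 : Q != 0.
  rewrite /Q scaler_eq0 negb_or a0/=; apply/prodf_neq0 => m _.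
  exact: expf_neq0.
have mQ : mup z0 Q = 1%N.
  rewrite /Q -mul_polyC mupMr; last by rewrite rootC.
  rewrite (bigD1 i)//= mupMl; last first.
    rewrite rootE horner_prod; apply/prodf_neq0 => m mi; exact: Wm.
  rewrite (_ : e i = 1%N) ?expr1; last by rewrite /e ki.
  by rewrite Wi mupMr ?rootC// mup_XsubCX eqxx.
have f0 : f != 0.
  apply: contra_eq_neq key => ->; rewrite expr0n/= mul0r eq_sym.
  by rewrite mulf_neq0// expf_neq0.
have := congr1 (odd \o mup z0) key; rewrite /=.
rewrite !expr2 !mupM ?mulf_neq0// mQ !oddD !addbb/=.
by [].
Qed.

End not_square.

(** * Cross-ratios and normal forms *)

Section cross_ratio.
Local Open Scope classical_set_scope.
Local Open Scope ring_scope.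
Context {R : realType} {r : nat}.
Variable k : 'I_r -> int.
Local Notation C := R[i].
Local Notation nrm := (@Normc.normc R).
Local Notation X := (C * 'M[C]_(r, 2))%type.
Hypothesis k_ge : forall i, -1 <= k i.
Hypothesis ksum : \sum_(i < r) k i = -4.
Implicit Types (a b : X) (i j l m t : 'I_r).

Lemma is_qdiffE : is_qdiff k = @regular R r.
Proof.
apply/seteqP; split => a [a0 sa wa]; first by move=> _; split.
by split => //; apply: (not_square k_ge ksum).
Qed.

(** The modulus of the cross-ratio of four singularities: it is large when i
    is close to l or m is close to j. *)
Definition cross a i j m l : R :=
  nrm (wedge (sing a i) (sing a j) * wedge (sing a m) (sing a l)) /
  nrm (wedge (sing a i) (sing a l) * wedge (sing a m) (sing a j)).

Lemma cross_transport a b (g : 'M[C]_2) (c : 'I_r -> C) (s : 'I_r -> 'I_r) :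
  g \in unitmx -> (forall i, c i != 0) ->
  (forall i, sing b (s i) = c i *: (sing a i *m g)) ->
  forall i j m l, cross b (s i) (s j) (s m) (s l) = cross a i j m l.
Proof.
move=> gu c0 sE i j m l.
have d0 : \det g != 0 by move: gu; rewrite unitmxE unitfE.
have wE t t' : wedge (sing b (s t)) (sing b (s t')) =
    c t * c t' * \det g * wedge (sing a t) (sing a t').
  by rewrite !sE wedgeZl wedgeZr wedge_mulmx; ring.
rewrite /cross !wE.
set w1 := wedge _ _; set w2 := wedge _ _; set w3 := wedge _ _; set w4 := wedge _ _.
set e := c i * c j * c m * c l * \det g ^+ 2.
have e0 : e != 0 by rewrite !mulf_neq0// expf_neq0.
have -> : c i * c j * \det g * w1 * (c m * c l * \det g * w2) = e * (w1 * w2) by rewrite /e; ring.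
have -> : c i * c l * \det g * w3 * (c m * c j * \det g * w4) = e * (w3 * w4) by rewrite /e; ring.
by rewrite !(Normc.normcM e) -mulf_div divff ?mul1r// nrm_eq0.
Qed.

Lemma cross_isomorphic a b : isomorphic k a b -> exists2 s : 'S_r, (forall i, k (s i) = k i) &
  forall i j m l, cross b (s i) (s j) (s m) (s l) = cross a i j m l.
Proof.
move=> [g [s [gu ks sg _]]]; exists s => //.
have /choice[c cP] : forall i, exists c, c != 0 /\ sing b (s i) = c *: (sing a i *m g).
  by move=> i; have [c c0 sE] := sg i; exists c.
by apply: (@cross_transport a b g c s) => // i; have [] := cP i.
Qed.

Lemma cross_moebius g (c : 'I_r -> C) a i j m l : g \in unitmx -> (forall i, c i != 0) ->
  cross (moebius k g c a) i j m l = cross a i j m l.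
Proof.
move=> gu c0; apply: (@cross_transport a (moebius k g c a) g c id) => // t.
exact: sing_moebius.
Qed.

Definition vec (x y : C) : 'rV[C]_2 := \row_(j < 2) if j == ord0 then x else y.

Lemma vec0 (x y : C) : vec x y ord0 ord0 = x. Proof. by rewrite mxE. Qed.
Lemma vec1 (x y : C) : vec x y ord0 ord_max = y. Proof. by rewrite mxE. Qed.

Lemma wedge_vec (x y x' y' : C) : wedge (vec x y) (vec x' y') = x * y' - y * x'.
Proof. by rewrite /wedge !mxE. Qed.

(** The singularities j, l, m are at infinity, 0 and 1, and the others are given
    by affine coordinates. *)
Definition normalized j l m : set X := [set a |
  [/\ sing a j = vec 1 0, sing a l = vec 0 1, sing a m = vec 1 1 &
      forall t, t != j -> sing a t ord0 ord_max = 1]].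

Definition coord a t : C := sing a t ord0 ord0.

Lemma normalized_sing j l m a t : normalized j l m a -> t != j -> sing a t = vec (coord a t) 1.
Proof. by move=> [_ _ _ h] tj; apply/row2P; rewrite ?vec0 ?vec1// h. Qed.

Lemma normalized_cross j l m a i : normalized j l m a -> uniq [:: i; j; m; l] ->
  cross a i j m l = (nrm (coord a i))^-1.
Proof.
move=> na; have [aj al am _] := na.
rewrite /= !inE !negb_or => /and4P[/and3P[ij im il] /andP[jm jl] ml _].
rewrite /cross (normalized_sing na ij) aj al am !wedge_vec.
by rewrite !Normc.normcM !(mulr0, mulr1, mul0r, sub0r, subr0, mul1r) !nrmN !Normc.normc1 !mulr1 mul1r.
Qed.

(** The Moebius map is z |-> ((z - l) (m - j)) / ((z - j) (m - l)), in homogeneous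
    coordinates. *)
Lemma exists_normalized j l m a : uniq [:: j; l; m] -> regular a ->
  exists b, [/\ isomorphic k a b, regular b, normalized j l m b &
    forall i i' i'' i''', cross b i i' i'' i''' = cross a i i' i'' i'''].
Proof.
rewrite /= !inE negb_or => /and3P[/andP[jl jm] lm _] ra; have [a0 sa wa] := ra.
pose w i i' := wedge (sing a i) (sing a i').
have w0 i i' : i != i' -> w i i' != 0 by exact: wa.
pose x (v : 'rV[C]_2) := wedge v (sing a l) * w m j.
pose y (v : 'rV[C]_2) := wedge v (sing a j) * w m l.
pose sl c := sing a l ord0 c; pose sj c := sing a j ord0 c.
pose g : 'M[C]_2 := \matrix_(p, c)
  if p == ord0 then (if c == ord0 then sl ord_max * w m j else sj ord_max * w m l)
  else (if c == ord0 then - sl ord0 * w m j else - sj ord0 * w m l).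
have gE v : v *m g = vec (x v) (y v).
  by apply/row2P; rewrite row_mulE2 !mxE/= /x /y /wedge -/(sl _) -/(sl _) -/(sj _) -/(sj _); ring.
have gu : g \in unitmx.
  rewrite unitmxE unitfE det2 !mxE/=.
  rewrite (_ : _ - _ = w m j * w m l * w l j); last by rewrite /w/wedge -/(sl _) -/(sl _) -/(sj _) -/(sj _); ring.
  by rewrite !mulf_neq0// w0// eq_sym.
pose c t := if t == j then (x (sing a j))^-1 else (y (sing a t))^-1.
have xj : x (sing a j) != 0 by rewrite mulf_neq0// ?w0// eq_sym.
have yt t : t != j -> y (sing a t) != 0.
  by move=> tj; rewrite mulf_neq0// ?w0// eq_sym.
have c0 t : c t != 0 by rewrite /c; case: ifPn => tj; rewrite invr_eq0// yt.
exists (moebius k g c a); split; first exact: isomorphic_moebius.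
- exact: moebius_regular.
- split.
- rewrite sing_moebius gE /c eqxx; apply/row2P; rewrite mxE ?vec0 ?vec1.
    by rewrite mulVf.
  by rewrite /y wedgevv mul0r mulr0.
- rewrite sing_moebius gE /c eq_sym (negbTE jl); apply/row2P; rewrite mxE ?vec0 ?vec1.
    by rewrite /x wedgevv mul0r mulr0.
  by rewrite mulVf// yt// eq_sym.
- have mj : m != j by rewrite eq_sym.
  rewrite sing_moebius gE /c (negbTE mj); apply/row2P; rewrite mxE ?vec0 ?vec1; last by rewrite mulVf// yt.
  have -> : x (sing a m) = y (sing a m) by rewrite /x /y mulrC.
  by rewrite mulVf// yt.
- by move=> t tj; rewrite sing_moebius gE /c (negbTE tj) mxE vec1 mulVf// yt.
- by move=> *; exact: cross_moebius.
Qed.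

End cross_ratio.

(** * Arcs avoiding finitely many points *)

Section punctured_path.
Local Open Scope classical_set_scope.
Local Open Scope ring_scope.
Context {R : realType}.
Local Notation C := R[i].
Local Notation nrm := (@Normc.normc R).

Definition arc (e s : R) : C := Complex s (e * (s * (1 - s))).

Lemma arc0 e : arc e 0 = 0. Proof. by rewrite /arc mul0r mulr0. Qed.
Lemma arc1 e : arc e 1 = 1. Proof. by rewrite /arc subrr !mulr0. Qed.

(** Parabolic arcs of different heights only meet at 0 and 1, so that finitely
    many other points forbid finitely many of them. *)
Lemma arc_avoid (T : finType) (z : T -> C) (d : R) : 0 < d ->
  (forall t, z t != 0 /\ z t != 1) ->
  exists2 e, 0 < e < d & forall s t, arc e s != z t.
Proof.
move=> d0 z01.
(* The height of the only arc that may pass through z t. *)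
pose bad t := complex.Im (z t) / (complex.Re (z t) * (1 - complex.Re (z t))).
have [c c0 cP] := @finite_pos_lbound R T (fun t => 0 < bad t) bad (fun t h => h).
exists (Num.min c d / 2).
  rewrite divr_gt0 ?lt_min ?c0//= (@le_lt_trans _ _ (d / 2))//.
    by rewrite ler_pM2r ?invr_gt0// ge_min lexx orbT.
  by rewrite ltr_pdivrMr// ltr_pMr// ltr1n.
set e := _ / 2; have e0 : 0 < e by rewrite divr_gt0 ?lt_min ?c0.
have ec : e < c.
  rewrite (@le_lt_trans _ _ (c / 2))//; first by rewrite ler_pM2r ?invr_gt0// ge_min lexx.
  by rewrite ltr_pdivrMr// ltr_pMr// ltr1n.
move=> s t; apply/eqP => E; have [z0 z1] := z01 t.
have bE : s * (1 - s) != 0 -> bad t = e by move=> ss; rewrite /bad -E /= mulfK.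
have [/eqP|ss] := eqVneq (s * (1 - s)) 0; last first.
  by have := cP t; rewrite bE// e0 => /(_ isT); rewrite leNgt ec.
rewrite mulf_eq0 subr_eq0 => /orP[/eqP s0|/eqP s1].
  by rewrite -E s0 arc0 eqxx in z0.
by rewrite -E -s1 arc1 eqxx in z1.
Qed.

Lemma nrm_leD (x y : R) : nrm (Complex x y) <= `|x| + `|y|.
Proof.
rewrite /= -(ler_pXn2r (n := 2)) ?nnegrE ?sqrtr_ge0 ?addr_ge0//.
rewrite sqr_sqrtr ?addr_ge0 ?sqr_ge0// sqrrD !real_normK ?num_real//.
by rewrite addrAC lerDl mulrn_wge0// mulr_ge0.
Qed.

Lemma cvg_Complex (T : Type) (F : set_system T) (u v : T -> R) (x y : R) : Filter F ->
  u @ F --> x -> v @ F --> y -> (Complex (u t) (v t) : C) @[t --> F] --> (Complex x y : C).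
Proof.
move=> FF ux vy; apply/cvgrPdist_lt => e /gt0_complexE[-> e0].
have e20 : 0 < complex.Re e / 2 by exact: divr_gt0.
have /cvgrPdist_lt/(_ _ e20) h1 := ux; have /cvgrPdist_lt/(_ _ e20) h2 := vy.
apply: filterS2 h1 h2 => t h1 h2.
rewrite normc_def ltcR; apply: (le_lt_trans (nrm_leD (x - u t) (y - v t))).
by rewrite (splitr (complex.Re e)) ltrD.
Qed.

Lemma continuous_arc e : continuous (arc e).
Proof.
move=> s; apply: cvg_Complex; first exact: cvg_id.
apply: cvgM; first exact: cvg_cst.
apply: cvgM; first exact: cvg_id.
by apply: cvgB; [exact: cvg_cst|exact: cvg_id].
Qed.

(** The segment from p to q stays in the disc of radius b, and the arc is within
    e |q - p| of the segment. *)
Lemma nrm_arc_le e s (p q : C) (b : R) : 0 <= e -> 0 <= s <= 1 -> nrm p <= b -> nrm q <= b ->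
  nrm ((1 - arc e s) * p + arc e s * q) <= b + e * (nrm p + nrm q).
Proof.
move=> e0 /andP[s0 s1] pb qb.
have -> : (1 - arc e s) * p + arc e s * q =
   ((1 - s)%:C%C * p + s%:C%C * q) + (Complex 0 (e * (s * (1 - s)))) * (q - p).
  have -> : arc e s = s%:C%C + Complex 0 (e * (s * (1 - s))).
    by apply/eqP; rewrite eq_complex/= addr0 add0r !eqxx.
  have -> : (1 - s)%:C%C = 1 - s%:C%C :> C by rewrite rmorphB.
  by ring.
have n1 (x : R) : 0 <= x -> nrm x%:C%C = x.
  by move=> x0; rewrite /= expr0n addr0 sqrtr_sqr ger0_norm.
apply: (le_trans (ler_nrmD _ _)); apply: lerD.
  apply: (le_trans (ler_nrmD _ _)); rewrite !Normc.normcM !n1 ?subr_ge0//.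
  by nra.
have ss : 0 <= s * (1 - s) <= 1 by nra.
have -> : nrm ((0 +i* (e * (s * (1 - s))))%C * (q - p)) = (e * (s * (1 - s))) * nrm (q - p).
  rewrite Normc.normcM /= expr0n add0r sqrtr_sqr ger0_norm// mulr_ge0//.
  by case/andP: ss.
have := ler_nrmD q (- p); rewrite nrmN => h.
have q0 := nrm_ge0 (q - p).
case/andP: ss => ss0 ss1.
rewrite -mulrA ler_wpM2l// (le_trans _ (le_trans h _))//; last by rewrite addrC.
by rewrite ler_piMl.
Qed.

End punctured_path.

(** * Connected sets of normalized data *)

Section connected_slab.
Local Open Scope classical_set_scope.
Local Open Scope ring_scope.

Lemma connected_pairwise (T : topologicalType) (A : set T) :
  (forall x y, A x -> A y -> exists S, [/\ connected S, S `<=` A, S x & S y]) -> connected A.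
Proof.
move=> h; have [->|/set0P[x Ax]] := eqVneq A set0; first exact: connected0.
rewrite (_ : A = connected_component A x); first exact: component_connected.
apply/seteqP; split; last exact: connected_component_sub.
by move=> y Ay; have [S [cS SA Sx Sy]] := h x y Ax Ay; exists S.
Qed.

Context {R : realType} {r : nat}.
Local Notation C := R[i].
Local Notation nrm := (@Normc.normc R).
Local Notation X := (C * 'M[C]_(r, 2))%type.
Implicit Types (a b : X) (i j l m t : 'I_r).

(** The parameter is complex, to leave room for going around the roots of the
    functions that must not vanish. *)
Definition chord a b (z : C) : X := ((1 - z) * a.1 + z * b.1, (1 - z) *: a.2 + z *: b.2).

Lemma chord0 a b : chord a b 0 = a.
Proof. by rewrite /chord subr0 mul1r mul0r addr0 scale1r scale0r addr0 -surjective_pairing. Qed.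

Lemma chord1 a b : chord a b 1 = b.
Proof. by rewrite /chord subrr mul1r mul0r add0r scale1r scale0r add0r -surjective_pairing. Qed.

Lemma sing_chord a b z t c :
  sing (chord a b z) t ord0 c = (1 - z) * sing a t ord0 c + z * sing b t ord0 c.
Proof. by rewrite !mxE. Qed.

Lemma coord_chord a b z t : coord (chord a b z) t = (1 - z) * coord a t + z * coord b t.
Proof. exact: sing_chord. Qed.

Lemma chord_normalized j l m a b z :
  normalized j l m a -> normalized j l m b -> normalized j l m (chord a b z).
Proof.
move=> [aj al am ah] [bj bl bm bh]; split.
- by apply/row2P; rewrite sing_chord aj bj ?vec0 ?vec1; ring.
- by apply/row2P; rewrite sing_chord al bl ?vec0 ?vec1; ring.
- by apply/row2P; rewrite sing_chord am bm ?vec0 ?vec1; ring.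
- by move=> t tj; rewrite sing_chord ah// bh//; ring.
Qed.

(** Among two singularities, one at most is at infinity, and it is fixed; the
    second coordinates are constant. So the determinant is affine along a chord. *)
Lemma wedge_chord j l m a b z t t' : normalized j l m a -> normalized j l m b -> t != t' ->
  wedge (sing (chord a b z) t) (sing (chord a b z) t') =
  (1 - z) * wedge (sing a t) (sing a t') + z * wedge (sing b t) (sing b t').
Proof.
move=> na nb tt; rewrite /wedge !sing_chord.
have [aj _ _ ah] := na; have [bj _ _ bh] := nb.
have [tj|tj] := eqVneq t j.
  have t'j : t' != j by rewrite eq_sym -tj.
  by rewrite tj aj bj ?vec0 ?vec1 ah// bh//; ring.
have [t'j|t'j] := eqVneq t' j.
  by rewrite t'j aj bj ?vec0 ?vec1 ah// bh//; ring.
by rewrite !ah// !bh//; ring.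
Qed.

Lemma continuous_chord_arc a b e : continuous (chord a b \o arc e).
Proof.
move=> s.
have c0 := @continuous_arc R e s.
have c1 : (fun t : R => 1 - arc e t : C) @ s --> (1 - arc e s : C).
  exact: (cvgB (@cst_continuous R C 1 s) c0).
have lin (u v : C) : (fun t : R => (1 - arc e t) * u + arc e t * v : C) @ s -->
    ((1 - arc e s) * u + arc e s * v : C).
  exact: (cvgD (cvgM c1 (@cst_continuous R C u s)) (cvgM c0 (@cst_continuous R C v s))).
pose M (t : R) : 'M[C]_(r, 2) := (1 - arc e t) *: a.2 + arc e t *: b.2.
have ent i (j : 'I_2) : (fun t : R => M t i j) @ s --> M s i j.
  have -> : (fun t : R => M t i j) = (fun t : R => (1 - arc e t) * a.2 i j + arc e t * b.2 i j).
    by apply/funext => t; rewrite !mxE.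
  by rewrite !mxE; exact: lin.
have h2 : M @ s --> M s by exact: cvg_mx ent.
exact: (cvg_pair (lin a.1 b.1) h2).
Qed.

(** The root of z |-> (1 - z) u + z v. If u = v there is none, and 2 stands for
    any value other than 0 and 1. *)
Let zero (u v : C) : C := if u == v then 2 else u / (u - v).

Let zero01 u v : u != 0 -> v != 0 -> zero u v != 0 /\ zero u v != 1.
Proof.
rewrite /zero => u0 v0; case: ifPn => uv.
  by rewrite pnatr_eq0 -(subr_eq0 2) (_ : 2 - 1 = 1 :> C) ?oner_eq0//; ring.
have uv0 : u - v != 0 by rewrite subr_eq0.
split; first by rewrite mulf_neq0// invr_eq0.
apply: contra v0 => /eqP /(congr1 ( *%R^~ (u - v))); rewrite divfK// mul1r => e.
by apply/eqP; rewrite -[v](subKr u) -e subrr.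
Qed.

Let zeroP u v z : u != 0 -> z != zero u v -> (1 - z) * u + z * v != 0.
Proof.
move=> u0; apply: contra => /eqP e.
have e' : z * (u - v) = u.
  by rewrite -[RHS](subr0) -e; ring.
rewrite /zero; case: ifPn => uv.
  by move: u0; rewrite -e' (eqP uv) subrr mulr0 eqxx.
by rewrite -[X in _ == X / _]e' mulfK// subr_eq0.
Qed.

(** By [normalized_cross], this says that the cross-ratio of i, j, m, l exceeds
    1 / e. *)
Definition slab i j m l (e : R) : set X :=
  [set a | [/\ normalized j l m a, regular a & nrm (coord a i) < e]].

(** Regularity means that finitely many functions, affine along a chord, do not
    vanish; a generic arc avoids their roots. The condition on the coordinate
    of i is convex and open, so an arc close enough to the segment keeps it. *)
Lemma connected_slab i j m l e : connected (slab i j m l e).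
Proof.
apply: connected_pairwise => a b [na ra ae] [nb rb be].
have [a0 sa wa] := ra; have [b0 sb wb] := rb.
pose f (o : option ('I_r * 'I_r)) (c : X) : C := if o is Some tt' then
  if tt'.1 == tt'.2 then 1 else wedge (sing c tt'.1) (sing c tt'.2) else c.1.
have f0 (c : X) o : regular c -> f o c != 0.
  move=> [c0 _ wc]; case: o => [[t t']|//] /=; case: ifPn => tt; last exact: wc.
  exact: oner_neq0.
pose M := Num.max (nrm (coord a i)) (nrm (coord b i)).
have Me : M < e by rewrite gt_max ae be.
pose d := (e - M) / (nrm (coord a i) + nrm (coord b i) + 1).
have S0 : 0 < nrm (coord a i) + nrm (coord b i) + 1 by rewrite ltr_wpDl// addr_ge0// nrm_ge0.
have d0 : 0 < d by rewrite divr_gt0// subr_gt0.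
have [h /andP[h0 hd] hP] := arc_avoid d0 (fun o => zero01 (f0 a o ra) (f0 b o rb)).
exists ((chord a b \o arc h) @` `[0, 1]); split.
- apply: connected_continuous_connected; first exact: segment_connected.
  by apply: continuous_subspaceT; exact: continuous_chord_arc.
- move=> _ [s /= s01 <-]; rewrite in_itv/= in s01.
  have nc := chord_normalized (arc h s) na nb.
  have wc t t' : t != t' -> wedge (sing (chord a b (arc h s)) t) (sing (chord a b (arc h s)) t') != 0.
    move=> tt; rewrite (wedge_chord _ na nb tt); apply: zeroP; first exact: wa.
    by have := hP s (Some (t, t')); rewrite /f/= (negbTE tt).
  split => //.
  + split => //; first by apply: zeroP => //; exact: (hP s None).
    move=> t; have [tj|tj] := eqVneq t j.
      have [ej _ _ _] := nc; rewrite tj ej; apply/eqP => /rowP/(_ ord0).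
      by rewrite vec0 mxE => /eqP; rewrite oner_eq0.
    have [_ _ _ /(_ t tj) e1] := nc; apply: contra_eq_neq e1 => ->.
    by rewrite mxE eq_sym oner_neq0.
  + rewrite coord_chord.
    apply: (le_lt_trans (nrm_arc_le (b := M) (ltW h0) s01 _ _)); rewrite ?le_max ?lexx ?orbT//.
    rewrite -ltrBrDl (@le_lt_trans _ _ (h * (nrm (coord a i) + nrm (coord b i) + 1)))//.
      by rewrite ler_pM2l// lerDl.
    by rewrite -ltr_pdivlMr.
- by exists 0; rewrite /= ?in_itv/= ?lexx ?ler01// arc0 chord0.
- by exists 1; rewrite /= ?in_itv/= ?lexx ?ler01// arc1 chord1.
Qed.

End connected_slab.

(** * Spaces with one end *)

Section unique_end.
Local Open Scope classical_set_scope.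
Context {W : topologicalType}.
Variables U E : nat -> set W.
Hypothesis openU : forall n, open (U n).
Hypothesis leU : forall m n, (m <= n)%N -> U m `<=` U n.
Hypothesis coverU : forall w, exists n, U n w.
Hypothesis connectedE : forall n, connected (E n).
Hypothesis E0 : forall n, E n !=set0.
Hypothesis UE : forall n, U n `<=` ~` E n.
Hypothesis cptE : forall n, precompact (~` E n).

Let compact_sub (K : set W) : compact K -> exists n, K `<=` U n.
Proof.
move=> /compact_near_coveringP cK.
have [//|n _ nP] := cK nat \oo U _.
  move=> x Kx; have [n Unx] := coverU x.
  exists (U n, [set m | (n <= m)%N]) => /=.
    by split; [exact: open_nbhs_nbhs|exists n].
  by case=> y m [/= Uy nm]; exact: leU nm _ Uy.
by exists n; apply: nP => /=.
Qed.

Let unbounded n A : E n `<=` A -> ~ precompact A.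
Proof.
move=> EA [V AV [cV _]]; have [V' EV' [cV' _]] := cptE n.
have cT : compact [set: W].
  rewrite (_ : setT = V' `|` V); first exact: compactU.
  apply/esym; rewrite -subTset => w _; have [Ew|Ew] := pselect (E n w).
    by right; apply: AV; exact: EA.
  by left; exact: EV'.
have [m mP] := compact_sub cT; have [w Ew] := E0 m.
exact: (UE (mP w I)).
Qed.

Let meets n A : ~ precompact A -> A `&` E n !=set0.
Proof.
move=> nA; apply: contrapT => h; apply: nA; apply: precompact_subset (cptE n).
by move=> w Aw Ew; apply: h; exists w.
Qed.

(** A compact set lies in some U n, hence misses E n. The component of its
    complement that contains the connected set E n is not relatively compact;
    any other component is contained in the relatively compact set ~` E n. *)
Lemma unique_end : exists! e : {K : set W | compact K} -> set W, is_end e.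
Proof.
pose N (K : {K : set W | compact K}) : nat := sval (cid (compact_sub (svalP K))).
have NP K : sval K `<=` U (N K) by rewrite /N; case: cid.
pose x n : W := sval (cid (E0 n)); have xP n : E n (x n) by rewrite /x; case: cid.
pose e K := connected_component (~` sval K) (x (N K)).
have Esub K : E (N K) `<=` ~` sval K by move=> w Ew /NP/UE.
have Ee K : E (N K) `<=` e K by apply: connected_component_max.
(* A component of the complement that is not precompact meets E (N K). *)
have eP K A y : ~ precompact A -> A `<=` connected_component (~` sval K) y ->
    connected_component (~` sval K) y = e K.
  move=> /(meets (N K))[w [Aw Ew]] /(_ w Aw) yw.
  by rewrite (same_connected_component yw) /e (same_connected_component (Ee K w Ew)).
exists e; split.
  split=> [K|K L KL].
    split; first by exists (x (N K)) => //; exact/Esub/xP.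
    exact: unbounded (Ee K).
  have nL : ~ precompact (e L) by exact: unbounded (Ee L).
  have [w [ew Ew]] := meets (N K) nL.
  have LK : ~` sval L `<=` ~` sval K by exact: subsetC.
  rewrite -(eP K (e L) (x (N L)) nL) => z [B [Bx BL cB] Bz];
    by exists B => //; split => //; exact: subset_trans LK.
move=> e' [e'P _]; apply/funext => K.
by have [[y Ky ->] ne] := e'P K; apply/esym; apply: eP ne _.
Qed.

End unique_end.

(** * Continuity and compactness for the modulus *)

Section modulus_topology.
Local Open Scope classical_set_scope.
Local Open Scope ring_scope.
Context {R : realType}.
Local Notation C := R[i].
Local Notation nrm := (@Normc.normc R).

Lemma cvg_nrm (T : Type) (F : set_system T) (u : T -> C) (z : C) : Filter F ->
  u @ F --> z -> nrm (u t) @[t --> F] --> nrm z.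
Proof.
move=> FF /cvg_complex_nrm uz; apply/cvgrPdist_lt => e e0.
have /cvgrPdist_lt/(_ _ e0) := uz; apply: filterS => t; move: (u t) => y; rewrite sub0r normrN ger0_norm ?nrm_ge0//.
apply: le_lt_trans; rewrite ler_norml; apply/andP; split.
  by rewrite lerNl opprB lerBlDr (le_trans _ (ler_nrmD _ _))// subrK.
rewrite lerBlDr (_ : nrm (y - z) = nrm (z - y)); last by rewrite -nrmN opprB.
by rewrite (le_trans _ (ler_nrmD _ _))// subrK.
Qed.

Lemma compact_disk (e : R) : compact [set z : C | nrm z <= e].
Proof.
have cI : compact (`[- e, e] `*` `[- e, e] : set (R * R)).
  by apply: compact_setX; exact: segment_compact.
pose f (p : R * R) : C := Complex p.1 p.2.
have cf : continuous f by move=> p; apply: cvg_Complex; [exact: cvg_fst|exact: cvg_snd].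
apply: (@subclosed_compact _ _ (f @` (`[- e, e] `*` `[- e, e]))).
- apply: (@preimage_closed _ _ (nrm : C -> R) [set x | x <= e]); last exact: closed_le.
  have idC : continuous (@id C) by move=> z; exact: cvg_id.
  by move=> z _; exact: (cvg_nrm _ (idC z)).
- by apply: continuous_compact => //; exact: continuous_subspaceT.
- move=> [x y] /= h; exists (x, y) => //=; rewrite !in_itv /= -!ler_norml.
  split; apply: le_trans h.
    by rewrite -sqrtr_sqr ler_wsqrtr// lerDl sqr_ge0.
  by rewrite -sqrtr_sqr ler_wsqrtr// lerDr sqr_ge0.
Qed.

Lemma closed_nrm_ge (T : topologicalType) (f : T -> C) (e : R) : continuous f ->
  closed [set t | e <= nrm (f t)].
Proof.
move=> cf; apply: (@preimage_closed _ _ (nrm \o f) [set x | e <= x]); last exact: closed_ge.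
by move=> t _; exact: (cvg_nrm _ (cf t)).
Qed.

End modulus_topology.

(** * Data with bounded and with large cross-ratios *)

Section configurations.
Local Open Scope classical_set_scope.
Local Open Scope ring_scope.
Context {R : realType} {r : nat}.
Local Notation C := R[i].
Local Notation nrm := (@Normc.normc R).
Local Notation X := (C * 'M[C]_(r, 2))%type.
Implicit Types (a b : X) (i j m l t : 'I_r).

Lemma continuous_cross a i j m l : regular a -> uniq [:: i; j; m; l] ->
  cross b i j m l @[b --> a] --> cross a i j m l.
Proof.
move=> [_ _ wa]; rewrite /= !inE !negb_or => /and4P[/and3P[ij im il] /andP[jm jl] ml _].
apply: cvgM; last apply: cvgV.
- by apply: cvg_nrm; apply: cvgM; exact: continuous_wedge.
- by rewrite nrm_eq0 mulf_neq0// wa// eq_sym.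
- by apply: cvg_nrm; apply: cvgM; exact: continuous_wedge.
Qed.

Definition below (N : R) : set X :=
  [set a | forall i j m l : 'I_r, uniq [:: i; j; m; l] -> cross a i j m l < N].

Definition above (N : R) : set X :=
  [set a | exists i j m l : 'I_r, uniq [:: i; j; m; l] /\ N < cross a i j m l].

Lemma below_near N a : regular a -> below N a -> \forall b \near a, below N b.
Proof.
move=> ra aN; pose P (i j m l : 'I_r) (b : X) := uniq [:: i; j; m; l] -> cross b i j m l < N.
refine (@filter_forall X 'I_r (fun i b => forall j m l, P i j m l b) (nbhs a) _ _) => i.
refine (@filter_forall X 'I_r (fun j b => forall m l, P i j m l b) (nbhs a) _ _) => j.
refine (@filter_forall X 'I_r (fun m b => forall l, P i j m l b) (nbhs a) _ _) => m.
refine (@filter_forall X 'I_r (P i j m) (nbhs a) _ _) => l; rewrite /P.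
have [u|] := boolP (uniq [:: i; j; m; l]); last by move=> nu; exact: nearW.
have := continuous_cross ra u => /cvgr_lt/(_ _ (aN i j m l u)).
by apply: filterS.
Qed.

Lemma above_near N a : regular a -> above N a -> \forall b \near a, above N b.
Proof.
move=> ra [i [j [m [l [u aN]]]]].
have := continuous_cross ra u => /cvgr_gt/(_ _ aN).
by apply: filterS => b bN; exists i, j, m, l.
Qed.

Lemma exists_below a : exists n : nat, below n%:R a.
Proof.
have c0 i j m l : 0 <= cross a i j m l by rewrite divr_ge0 ?nrm_ge0.
pose S := \sum_(q : 'I_r * 'I_r * ('I_r * 'I_r)) cross a q.1.1 q.1.2 q.2.1 q.2.2.
exists (Num.bound S) => i j m l _; apply: le_lt_trans (archi_boundP _).
  by rewrite /S (bigD1 ((i, j), (m, l)))//= lerDl sumr_ge0.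
by rewrite sumr_ge0.
Qed.

(** Coordinates on the data whose j-th singularity is at infinity. *)
Definition frame (j : 'I_r) (p : C * 'rV[C]_r) : X :=
  (p.1, \matrix_(t < r, c < 2)
     if t == j then (c == ord0)%:R else if c == ord0 then p.2 ord0 t else 1).

Lemma continuous_frame j : continuous (frame j).
Proof.
move=> p; have h1 : (frame j q).1 @[q --> p] --> (frame j p).1 by exact: cvg_fst.
have h2 : (frame j q).2 @[q --> p] --> (frame j p).2.
  apply: cvg_mx => t c; rewrite mxE.
  have -> : (fun q : C * 'rV[C]_r => (frame j q).2 t c : C) = (fun q =>
      if t == j then (c == ord0)%:R else if c == ord0 then q.2 ord0 t else 1).
    by apply/funext => q; rewrite mxE.
  case: ifP => _; first exact: cvg_cst.
  case: ifP => _; last exact: cvg_cst.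
  exact: (cvg_comp (fun q : C * 'rV[C]_r => q.2) (fun M : 'rV[C]_r => M ord0 t)
    cvg_snd (@continuous_mx_entry C 1 r ord0 t p.2)).
exact: (cvg_pair h1 h2).
Qed.

(** The bounds satisfied by normal forms whose cross-ratios are at most N. That the
    constant has modulus 1 is written as two closed conditions. *)
Definition thick (j : 'I_r) (N : R) : set X :=
  frame j @` (([set z : C | 1 <= nrm z] `&` [set z : C | nrm z <= 1]) `*`
              [set x : 'rV[C]_r | forall t, nrm (x ord0 t) <= N]) `&`
  \bigcap_(q in [set q : 'I_r * 'I_r | q.1 != q.2])
    [set a | N ^- 2 <= nrm (wedge (sing a q.1) (sing a q.2))].

Lemma compact_thick j N : compact (thick j N).
Proof.
apply: compact_closedI.
  apply: continuous_compact; first by apply: continuous_subspaceT; exact: continuous_frame.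
  apply: compact_setX.
    rewrite setIC; apply: compact_closedI; first exact: compact_disk.
    by apply: closed_nrm_ge => z; exact: cvg_id.
  have := @rV_compact C r (fun=> [set z : C | nrm z <= N]) (fun=> @compact_disk R N).
  by [].
apply: closed_bigI => q _; apply: closed_nrm_ge; exact: continuous_wedge.
Qed.

Lemma thick_regular j N : 0 < N -> thick j N `<=` @regular R r.
Proof.
move=> N0 _ [[[c x] [[/= c1 _] _] <-] wN]; split => /=.
- by rewrite -nrm_gt0 (lt_le_trans _ c1).
- move=> t; apply/eqP => /rowP e; have [tj|tj] := eqVneq t j.
    by have := e ord0; rewrite !mxE tj eqxx/= => /eqP; rewrite oner_eq0.
  by have := e ord_max; rewrite !mxE (negbTE tj) => /eqP; rewrite oner_eq0.
- move=> t t' tt; have := wN (t, t') tt => /=; apply: contraTneq => ->.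
  by rewrite (_ : nrm 0 = 0) ?Normc.normc0// -ltNge invr_gt0 exprn_gt0.
Qed.

End configurations.

(** * Configurations with two close singularities *)

Section close_pair.
Local Open Scope classical_set_scope.
Local Open Scope ring_scope.
Context {R : realType} {r : nat}.
Local Notation C := R[i].
Local Notation nrm := (@Normc.normc R).
Local Notation X := (C * 'M[C]_(r, 2))%type.

Definition points (x : 'I_r -> C) : X :=
  (1, \matrix_(i < r, c < 2) if c == ord0 then x i else 1).

Lemma sing_points x i : sing (points x) i = vec (x i) 1.
Proof. by apply/rowP => c; rewrite !mxE. Qed.

Lemma wedge_points x i j : wedge (sing (points x) i) (sing (points x) j) = x i - x j.
Proof. by rewrite !sing_points wedge_vec mulr1 mul1r. Qed.

Lemma points_regular x : injective x -> regular (points x).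
Proof.
move=> xi; split => [|i|i j ij]; first exact: oner_neq0.
  rewrite sing_points; apply/eqP => /rowP/(_ ord_max); rewrite vec1 mxE.
  by move/eqP; rewrite oner_eq0.
by rewrite wedge_points subr_eq0; apply: contra ij => /eqP/xi ->.
Qed.

Variable N : R.
Hypothesis N0 : 0 < N.

(** Less than 1 / 2, so that positions at integers stay apart, and such that
    1 / (2 eps) exceeds r N, the lower bound that [near_pair_cross] asks for. *)
Let eps : R := (2 * (r%:R * N + 1))^-1.

Definition near_pair_pos (a b t : 'I_r) : R := if t == b then a%:R + eps else t%:R.

Definition near_pair (a b : 'I_r) : X := points (fun t => (near_pair_pos a b t)%:C%C).

Let rN : 0 <= r%:R * N. Proof. by rewrite mulr_ge0// ltW. Qed.

Let eps_gt0 : 0 < eps. Proof. by rewrite invr_gt0 mulr_gt0// ltr_wpDl. Qed.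

Let eps_le : eps <= 2^-1.
Proof. by rewrite lef_pV2 ?posrE ?mulr_gt0 ?ltr_wpDl// ler_peMr// lerDr. Qed.

Let dist_nat (m n : nat) : m != n -> 1 <= `|m%:R - n%:R : R|.
Proof.
wlog mn : m n / (n < m)%N.
  by case: (ltngtP m n) => // h H _; [rewrite distrC|]; apply: H => //; lia.
move=> _; rewrite -natrB ?(ltnW mn)// ger0_norm//; rewrite (ler_nat R 1); lia.
Qed.

Lemma near_pair_regular p q : p != q -> regular (near_pair p q).
Proof.
move=> pq; apply: points_regular => t t' /(congr1 (@complex.Re R)) /=.
rewrite /near_pair_pos.
have far (u : 'I_r) : u != q -> p%:R + eps != u%:R :> R.
  move=> uq; apply/eqP => e; have [ua|/dist_nat] := eqVneq (u : nat) p.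
    by move/eqP: e; rewrite ua -subr_eq0 addrAC subrr add0r gt_eqF.
  rewrite -e addrAC subrr add0r ger0_norm ?(ltW eps_gt0)// leNgt (le_lt_trans eps_le)//.
  by rewrite invf_lt1// ltr1n.
case: eqVneq => [->|tq]; case: eqVneq => [->|t'q] //.
- by move=> e; have := far _ t'q; rewrite e eqxx.
- by move=> e; have := far _ tq; rewrite e eqxx.
- by move=> /eqP; rewrite eqr_nat => /eqP/val_inj.
Qed.

(** All distances are between 1 / 2 and r, but for the distance eps of p to q. *)
Lemma near_pair_cross p q j m : uniq [:: p; j; m; q] -> N < cross (near_pair p q) p j m q.
Proof.
rewrite /= !inE !negb_or => /and4P[/and3P[pj pm pq] /andP[jm jq] mq _].
have nC (x : R) : nrm x%:C%C = `|x| by rewrite /= expr0n addr0 sqrtr_sqr.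
rewrite /cross !wedge_points -!rmorphB -!rmorphM !nC !normrM.
rewrite /near_pair_pos (negbTE pq) (negbTE jq) (negbTE mq) eqxx.
have -> : `|p%:R - (p%:R + eps)| = eps.
  by rewrite opprD addNKr normrN ger0_norm// ltW.
have pj1 : 1 <= `|p%:R - j%:R : R| by exact: dist_nat.
have mj0 : 0 < `|m%:R - j%:R : R| by apply: lt_le_trans (dist_nat _); rewrite // eq_sym.
have mjr : `|m%:R - j%:R : R| <= r%:R.
  rewrite ler_norml; have := ltn_ord m; have := ltn_ord j; rewrite -!(ltr_nat R) => h1 h2.
  have := ler0n R m; have := ler0n R j; lra.
have mq2 : 2^-1 <= `|m%:R - (p%:R + eps)|.
  have mp1 : 1 <= `|m%:R - p%:R : R| by apply: dist_nat; rewrite eq_sym.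
  have := ler_distD (p%:R + eps) m%:R (p%:R : R); rewrite addrAC subrr add0r (ger0_norm (ltW eps_gt0)).
  move: eps_le mp1; lra.
rewrite ltr_pdivlMr ?mulr_gt0//.
have h1 : N * (eps * `|m%:R - j%:R|) <= N * (eps * r%:R).
  by rewrite !ler_pM2l.
have h2 : N * (eps * r%:R) < 2^-1.
  have : eps * (2 * (r%:R * N + 1)) = 1 by rewrite mulVf// gt_eqF// mulr_gt0// ltr_wpDl.
  by move: eps_gt0; nra.
apply: (le_lt_trans h1); apply: (lt_le_trans h2); apply: (le_trans mq2).
by rewrite ler_peMl.
Qed.

End close_pair.

(** * The stratum as an image of the regular data *)

Section moduli.
Local Open Scope classical_set_scope.
Local Open Scope ring_scope.
Local Open Scope quotient_scope.
Context {R : realType} {r : nat}.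
Variable k : 'I_r -> int.
Local Notation C := R[i].
Local Notation nrm := (@Normc.normc R).
Local Notation X := (C * 'M[C]_(r, 2))%type.
Local Notation qdiff := (set_type (@is_qdiff R r k)).
Hypothesis k_ge : forall i, -1 <= k i.
Hypothesis ksum : \sum_(i < r) k i = -4.
Implicit Types a b : X.

Definition rescale (c : R) a : X := (c%:C%C * a.1, a.2).

Lemma qcoef_rescale c a v : qcoef k (rescale c a) v = c%:C%C * qcoef k a v.
Proof. by rewrite /qcoef -mulrA. Qed.

Lemma rescale_regular c a : c != 0 -> regular a -> regular (rescale c a).
Proof.
move=> c0 [a0 sa wa]; split => //; rewrite mulf_neq0//.
by rewrite eq_complex/= eqxx andbT.
Qed.

Lemma rescale_isomorphic c a b :
  isomorphic k a b -> isomorphic k (rescale c a) (rescale c b).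
Proof.
move=> [g [s [gu ks sg qg]]]; exists g, s; split => // v.
by rewrite !qcoef_rescale -mulrA qg.
Qed.

Definition normalize a : X := rescale (fine (flat_area k a))^-1 a.

Lemma area_fin a : regular a -> flat_area k a \is a fin_num.
Proof.
move=> ra; have [a0 aoo _] := flat_area_regular k_ge ksum ra.
by rewrite ge0_fin_numE// ltW.
Qed.

Lemma area_gt0 a : regular a -> 0 < fine (flat_area k a).
Proof.
move=> ra; have [a0 aoo _] := flat_area_regular k_ge ksum ra.
by rewrite fine_gt0// a0.
Qed.

Lemma flat_area_rescale c a : 0 <= c -> flat_area k (rescale c a) = (c%:E * flat_area k a)%E.
Proof.
move=> c0; rewrite flat_area_scale; congr (_%:E * _)%E.
by rewrite /= expr0n addr0 sqrtr_sqr ger0_norm.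
Qed.

Lemma normalize_regular a : regular a -> regular (normalize a).
Proof. by move=> ra; apply: rescale_regular => //; rewrite invr_eq0 gt_eqF// area_gt0. Qed.

Lemma flat_area_normalize a : regular a -> flat_area k (normalize a) = 1%:E.
Proof.
move=> ra; rewrite flat_area_rescale ?invr_ge0 ?(ltW (area_gt0 ra))//.
by rewrite -[X in (_ * X)%E](fineK (area_fin ra)) -EFinM mulVf// gt_eqF// area_gt0.
Qed.

Lemma normalize_id a : flat_area k a = 1%:E -> normalize a = a.
Proof. by rewrite /normalize /rescale => ->; rewrite /= invr1 mul1r -surjective_pairing. Qed.

Lemma normalize_rescale c a : regular a -> 0 < c -> normalize (rescale c a) = normalize a.
Proof.
move=> ra c0; rewrite /normalize flat_area_rescale ?ltW// -(fineK (area_fin ra)) -EFinM /=.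
rewrite /rescale/= mulrA -rmorphM/= invfM mulrAC mulVf ?gt_eqF// mul1r.
by [].
Qed.

Lemma normalize_isomorphic a b : isomorphic k a b -> isomorphic k (normalize a) (normalize b).
Proof.
move=> ab; rewrite /normalize (flat_area_isomorphic ksum ab).
exact: rescale_isomorphic.
Qed.

Lemma continuous_normalize a : regular a -> normalize @ a --> normalize a.
Proof.
move=> ra; have [_ _ ca] := flat_area_regular k_ge ksum ra.
have fa : fine (flat_area k b) @[b --> a] --> fine (flat_area k a).
  by apply: fine_cvg; rewrite fineK//; exact: area_fin.
have ia : (fine (flat_area k b))^-1 @[b --> a] --> (fine (flat_area k a))^-1.
  by apply: cvgV => //; rewrite gt_eqF// area_gt0.
have h1 : (((fine (flat_area k b))^-1)%:C%C * b.1 : C) @[b --> a] --> ((fine (flat_area k a))^-1)%:C%C * a.1.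
  apply: cvgM; last exact: continuous_coef.
  by apply: cvg_Complex => //; exact: cvg_cst.
have h2 : b.2 @[b --> a] --> a.2 by exact: cvg_snd.
exact: (cvg_pair h1 h2).
Qed.

Lemma qdiff_regular (a : qdiff) : regular (val a).
Proof. by rewrite -(is_qdiffE k_ge ksum); exact: set_valP. Qed.

Lemma normalize_qdiff (a : qdiff) : normalize (val a) \in @is_qdiff R r k.
Proof.
have := normalize_regular (qdiff_regular a); move: (normalize _) => b rb.
by apply: mem_set; rewrite (is_qdiffE k_ge ksum).
Qed.

Definition normalizeq (a : qdiff) : qdiff :=
  exist (fun b : X => b \in @is_qdiff R r k) _ (normalize_qdiff a).

Lemma pi_area_one (a : qdiff) : \pi_(stratum R k) (normalizeq a) \in @area_one R r k.
Proof.
apply: mem_set; exists (normalizeq a) => //=.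
by apply: flat_area_normalize; exact: qdiff_regular.
Qed.

Definition moduli (a : qdiff) : stratum1 R k :=
  exist (fun w : stratum R k => w \in @area_one R r k) _ (pi_area_one a).

Lemma continuous_moduli : continuous moduli.
Proof.
have cn : continuous normalizeq.
  apply: continuous_comp_initial => a; apply: (@continuous_comp _ _ _ set_val normalize).
    exact: initial_continuous.
  by apply: continuous_normalize; exact: qdiff_regular.
apply: continuous_comp_initial => a.
apply: (@continuous_comp _ _ _ normalizeq (\pi_(stratum R k))); first exact: cn.
exact: pi_continuous.
Qed.

Lemma pi_eqP (a b : qdiff) :
  \pi_(stratum R k) a = \pi_(stratum R k) b <-> isomorphic k (val a) (val b).
Proof.
split.
  by move=> /eqmodP/asboolP.
by move=> ab; apply/eqmodP/asboolP.
Qed.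

Lemma moduliP (a b : qdiff) :
  moduli a = moduli b <-> isomorphic k (normalize (val a)) (normalize (val b)).
Proof.
split.
  by move=> /(congr1 val) /= /pi_eqP.
by move=> ab; apply: val_inj; apply/pi_eqP.
Qed.

Lemma moduli_surj (w : stratum1 R k) : exists a : qdiff, moduli a = w.
Proof.
have [a /= a1 aw] := set_valP w; exists a; apply: val_inj; rewrite /= -aw.
congr (\pi_(_) _); apply: val_inj => /=; exact: normalize_id.
Qed.

Lemma regular_qdiff a : regular a -> exists q : qdiff, val q = a.
Proof.
move=> ra; have qa : a \in @is_qdiff R r k by apply: mem_set; rewrite (is_qdiffE k_ge ksum).
by exists (exist (fun b : X => b \in @is_qdiff R r k) _ qa).
Qed.

Variable w0 : stratum1 R k.

(** The default value w0 makes the map total, so that continuity, connectedness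
    and compactness can be argued in the vector space of all data. *)
Definition proj : X -> stratum1 R k := valL_ w0 moduli.

Lemma projE (q : qdiff) : proj (val q) = moduli q.
Proof. exact: (congr1 (@^~ q) (valLK w0 moduli)). Qed.

Lemma continuous_proj : {within @regular R r, continuous proj}.
Proof.
rewrite -(is_qdiffE k_ge ksum); apply/subspace_valL_continuousP'.
exact: continuous_moduli.
Qed.

Lemma proj_surj w : exists2 a, regular a & proj a = w.
Proof.
have [q <-] := moduli_surj w; exists (val q); first exact: qdiff_regular.
exact: projE.
Qed.

Lemma proj_isomorphic a b : regular a -> regular b -> isomorphic k a b -> proj a = proj b.
Proof.
move=> /regular_qdiff[q <-] /regular_qdiff[q' <-] qq; rewrite !projE.
exact/moduliP/normalize_isomorphic.
Qed.

Lemma proj_rescale c a : regular a -> 0 < c -> proj (rescale c a) = proj a.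
Proof.
move=> ra c0; have ne := normalize_rescale ra c0.
have /regular_qdiff[q qE] : regular (rescale c a) by apply: rescale_regular; rewrite ?gt_eqF.
have [q' q'E] := regular_qdiff ra.
rewrite -qE -q'E !projE; apply/moduliP; rewrite qE q'E ne.
exact: isomorphic_refl.
Qed.

Lemma proj_eq a b : regular a -> regular b -> proj a = proj b -> isomorphic k (normalize a) (normalize b).
Proof.
by move=> /regular_qdiff[q <-] /regular_qdiff[q' <-]; rewrite !projE => /moduliP.
Qed.

Section invariant_sets.
Variable S : set X.
Hypothesis S_isomorphic : forall a b, isomorphic k a b -> S a -> S b.
Hypothesis S_rescale : forall c a, S (rescale c a) <-> S a.
Hypothesis S_near : forall a, regular a -> S a -> \forall b \near a, S b.

Lemma proj_invariant a : regular a -> (proj @` (@regular R r `&` S)) (proj a) <-> S a.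
Proof.
move=> ra; split=> [[b [rb Sb] /(proj_eq rb ra) ba]|Sa]; last by exists a.
by apply/(S_rescale (fine (flat_area k a))^-1)/(S_isomorphic ba)/S_rescale.
Qed.

(** An invariant set is its own preimage under the projection to the stratum, and
    the topologies on both sides are a quotient and an induced one. *)
Lemma open_proj_invariant : open (proj @` (@regular R r `&` S)).
Proof.
pose V : set (stratum R k) := [set x | exists2 q : qdiff, \pi_(stratum R k) q = x & S (val q)].
have Vpi q : V (\pi_(stratum R k) q) <-> S (val q).
  by split=> [[q' /pi_eqP/S_isomorphic]|Sq]; [exact|exists q].
exists V.
  change (open ((\pi_(stratum R k) : qdiff -> _) @^-1` V)); rewrite openE => q /Vpi Sq.
  have : \forall q' \near q, S (val q').
    exact: (@initial_continuous qdiff X set_val q _ (S_near (qdiff_regular q) Sq)).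
  by apply: filterS => q' Sq'; exact/Vpi.
apply/seteqP; split => w.
  have [q <-] := moduli_surj w; move=> /Vpi/S_rescale Sq.
  by exists (val q); [split => //; exact: qdiff_regular|exact: projE].
move=> [_ [/regular_qdiff[q <-] Sq] <-]; rewrite projE.
by apply/Vpi/S_rescale.
Qed.

End invariant_sets.

Lemma below_isomorphic N a b : isomorphic k a b -> below N a -> below N b.
Proof.
move=> /cross_isomorphic[s _ sE] aN i j m l u.
rewrite -(permKV s i) -(permKV s j) -(permKV s m) -(permKV s l) sE; apply: aN.
by rewrite -(map_inj_uniq (@perm_inj _ s)) /= !permKV.
Qed.

Lemma above_isomorphic N a b : isomorphic k a b -> above N a -> above N b.
Proof.
move=> /cross_isomorphic[s _ sE] [i [j [m [l [u aN]]]]].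
exists (s i), (s j), (s m), (s l); rewrite sE; split => //.
by rewrite -[uniq _](map_inj_uniq (@perm_inj _ s)) in u.
Qed.

(** * The parts with a large cross-ratio *)

Section pieces.
Variable N : R.
Hypothesis N0 : 0 < N.

Definition piece i j m l : set (stratum1 R k) :=
  proj @` [set a | regular a /\ N < cross a i j m l].

(** In normal form, a large cross-ratio is a small coordinate. *)
Lemma pieceE i j m l : uniq [:: i; j; m; l] ->
  piece i j m l = proj @` slab i j m l N^-1.
Proof.
move=> u; apply/seteqP; split=> _ [a aP <-].
  case: aP => ra aN.
  have u' : uniq [:: j; l; m].
    by move: u; rewrite /= !inE !negb_or [l == m]eq_sym => /and4P[_ /andP[-> ->] -> _].
  have [b [ab rb nb cE]] := exists_normalized ksum u' ra.
  exists b; last exact/esym/proj_isomorphic.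
  split => //; move: aN; rewrite -cE (normalized_cross nb u).
  have [b0|b0] := eqVneq (nrm (coord b i)) 0; first by rewrite b0 invr0 ltNge (ltW N0).
  by move=> h; rewrite -[ltLHS]invrK ltf_pV2// posrE// (lt_trans N0).
case: aP => na ra aN; exists a => //; split => //.
rewrite (normalized_cross na u) -[ltLHS]invrK ltf_pV2// ?posrE ?invr_gt0//.
rewrite nrm_gt0; have [_ _ wa] := ra.
move: u; rewrite /= !inE !negb_or => /and4P[/and3P[ij im il] _ _ _].
have [_ al _ _] := na; have := wa i l il; rewrite (normalized_sing na ij) al wedge_vec.
by rewrite mulr1 mulr0 subr0.
Qed.

Lemma connected_piece i j m l : uniq [:: i; j; m; l] -> connected (piece i j m l).
Proof.
move=> /pieceE ->; apply: connected_continuous_connected; first exact: connected_slab.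
by apply: continuous_subspaceW continuous_proj => a [].
Qed.

Lemma piece_swap i j m l : piece m l i j = piece i j m l.
Proof.
rewrite /piece; congr (_ @` _); apply/funext => a.
by rewrite /= /cross [wedge _ _ * _]mulrC [wedge (sing a m) (sing a j) * _]mulrC.
Qed.

Lemma near_pair_piece i j m l : uniq [:: i; j; m; l] -> piece i j m l (proj (near_pair N i l)).
Proof.
move=> u; exists (near_pair N i l) => //; split; last exact: near_pair_cross.
apply: (near_pair_regular N0); move: u; rewrite /= !inE !negb_or.
by case/and3P => /and3P[].
Qed.

Lemma near_pair_piece_dual i j m l : uniq [:: i; j; m; l] -> piece i j m l (proj (near_pair N m j)).
Proof.
move=> u; rewrite -piece_swap; apply: near_pair_piece.
by move: u; rewrite -(rot_uniq 2).
Qed.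

Let E : set (stratum1 R k) := proj @` (@regular R r `&` above N).

Let piece_sub i j m l : uniq [:: i; j; m; l] -> piece i j m l `<=` E.
Proof. by move=> u _ [a [ra aN] <-]; exists a => //; split => //; exists i, j, m, l. Qed.

Let linked (w w' : stratum1 R k) := connected_component E w w'.

Let piece_linked i j m l w w' : uniq [:: i; j; m; l] -> piece i j m l w -> piece i j m l w' ->
  linked w w'.
Proof.
move=> u wP w'P; exists (piece i j m l) => //; split => //; first exact: piece_sub.
exact: connected_piece.
Qed.

Let disjoint_linked i j m l : uniq [:: i; j; m; l] ->
  linked (proj (near_pair N i l)) (proj (near_pair N m j)).
Proof.
by move=> u; apply: (piece_linked u); [exact: near_pair_piece|exact: near_pair_piece_dual].
Qed.

(** Two pairs that meet involve three singularities at most, so with five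
    singularities some pair avoids both. *)
Let pairs_linked i l m j : (4 < r)%N -> i != l -> m != j ->
  linked (proj (near_pair N i l)) (proj (near_pair N m j)).
Proof.
move=> r5 il mj; have [u|nu] := boolP (uniq [:: i; j; m; l]); first exact: disjoint_linked.
have [e [f [eP fP ef]]] : exists e f, [/\ e \notin [:: i; j; m; l], f \notin [:: i; j; m; l] & e != f].
  have c3 : (#|[:: i; j; m; l]| <= 3)%N.
    rewrite -ltnS ltn_neqAle -[X in _ != X]/(size [:: i; j; m; l]) card_size andbT.
    by apply: contra nu => /eqP/card_uniqP.
  have : (1 < #|[predC [:: i; j; m; l]]|)%N.
    rewrite -(ltn_add2l #|[:: i; j; m; l]|) cardC card_ord (leq_ltn_trans _ r5)//.
    by rewrite addn1.
  by move=> /card_gt1P[e [f [eP fP ef]]]; exists e, f.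
have step p q : p != q -> p \in [:: i; j; m; l] -> q \in [:: i; j; m; l] ->
    linked (proj (near_pair N p q)) (proj (near_pair N e f)).
  move=> pq pP qP; apply: disjoint_linked.
  have pe : p != e by apply: contraNneq eP => <-.
  have qe : q != e by apply: contraNneq eP => <-.
  have pf : p != f by apply: contraNneq fP => <-.
  have qf : q != f by apply: contraNneq fP => <-.
  by rewrite /= !inE !negb_or pf pe pq [f == e]eq_sym ef [f == q]eq_sym qf [e == q]eq_sym qe.
apply: (@connected_component_trans _ _ (proj (near_pair N e f))).
  by apply: step => //; rewrite !inE eqxx ?orbT.
by apply: connected_component_sym; apply: step => //; rewrite !inE eqxx ?orbT.
Qed.

(** The numbers k i + 1 are nonnegative and sum to 0. *)
Let r4_pole : r = 4 -> forall i, k i = -1.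
Proof.
move=> r4 i; apply/eqP; rewrite -subr_eq0 opprK.
have k0 j : true -> 0 <= k j + 1 by move=> _; have := k_ge j; lia.
have : \sum_(j < r) (k j + 1) == 0 by rewrite big_split/= ksum sumr_const card_ord r4.
by rewrite (psumr_eq0 _ k0) => /allP/(_ i); rewrite mem_index_enum => /(_ isT).
Qed.

Let permute_rows (s : 'S_r) a : (forall i, k (s i) = k i) -> regular a ->
  exists b, [/\ regular b, isomorphic k a b & forall i, sing b (s i) = sing a i].
Proof.
move=> ks [a0 sa wa]; pose b : X := (a.1, row_perm s^-1 a.2).
have bE i : sing b (s i) = sing a i by apply/rowP => c; rewrite !mxE permK.
have bE' i : sing b i = sing a (s^-1%g i) by rewrite -bE permKV.
exists b; split => //.
  split => // [i|i j ij]; rewrite !bE' ?sa ?wa// (inj_eq perm_inj)//.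
exists 1%:M, s; split => //; first exact: unitmx1.
  by move=> i; exists 1; rewrite ?oner_neq0// bE mulmx1 scale1r.
move=> v; rewrite mulmx1 det1 expr1n mulr1 /qcoef; congr (_ * _).
by rewrite (reindex_inj (@perm_inj _ s))/=; apply: eq_bigr => i _; rewrite bE ks.
Qed.

Let piece_r4 i j m l i' j' m' l' : r = 4 -> uniq [:: i; j; m; l] -> uniq [:: i'; j'; m'; l'] ->
  piece i j m l `<=` piece i' j' m' l'.
Proof.
move=> r4 u u'.
have mem_all t : t \in [:: i; j; m; l].
  have r4' : (size (enum 'I_r) <= 4)%N by rewrite size_enum_ord r4.
  have [//|_ e] := uniq_min_size u _ r4'; first by move=> x _; rewrite mem_enum.
  by rewrite e mem_enum.
(* the relabelling that carries i, j, m, l to i', j', m', l' *)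
pose f t := nth i' [:: i'; j'; m'; l'] (index t [:: i; j; m; l]).
have f_inj : injective f.
  move=> t t' /eqP; rewrite /f nth_uniq ?index_mem//.
  by move=> /eqP/(congr1 (nth i [:: i; j; m; l])); rewrite !nth_index.
have fE (n : nat) : (n < 4)%N -> f (nth i [:: i; j; m; l] n) = nth i' [:: i'; j'; m'; l'] n.
  by move=> n4; rewrite /f index_uniq.
move=> _ [a [ra aN] <-].
have ks t : k (perm f_inj t) = k t by rewrite !(r4_pole r4).
have [b [rb ab bE]] := permute_rows ks ra.
exists b; last exact/esym/proj_isomorphic.
split => //; move: aN; rewrite /cross -!bE !permE.
by rewrite (fE 0%N) ?(fE 1%N) ?(fE 2%N) ?(fE 3%N).
Qed.

(** The piece of i, j, m, l contains configurations in which only i and l are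
    close, and others in which only m and j are. So pieces meet along the edges
    of the graph of disjoint pairs of singularities, which is connected for
    r >= 5. For r = 4 it is not, but all the pieces coincide. *)
Lemma connected_above : connected (proj @` (@regular R r `&` above N)).
Proof.
apply: connected_pairwise => w w'.
move=> [a [ra [i [j [m [l [u aN]]]]]] aw] [a' [ra' [i' [j' [m' [l' [u' aN']]]]]] aw'].
have P : piece i j m l w by exists a.
have P' : piece i' j' m' l' w' by exists a'.
suff [S [Sw SE cS] Sw'] : linked w w' by exists S.
have [r4|r4] := eqVneq r 4; first exact: piece_linked u' (piece_r4 r4 u u' P) P'.
have r5 : (4 < r)%N by rewrite ltn_neqAle eq_sym r4 (r_ge4 k_ge ksum).
apply: connected_component_trans (piece_linked u P (near_pair_piece u)) _.
apply: connected_component_trans (piece_linked u' (near_pair_piece u') P').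
apply: pairs_linked => //.
  by move: u; rewrite /= !inE !negb_or => /and3P[/and3P[]].
by move: u'; rewrite /= !inE !negb_or => /and3P[/and3P[]].
Qed.

Lemma above_nonempty : proj @` (@regular R r `&` above N) !=set0.
Proof.
have t_lt n : (n < 4)%N -> (n < r)%N by move=> n4; exact: leq_trans n4 (r_ge4 k_ge ksum).
pose t n (n4 : (n < 4)%N) : 'I_r := Ordinal (t_lt n n4).
have u : uniq [:: t 0%N isT; t 1%N isT; t 2%N isT; t 3%N isT] by [].
by have [w wP] := ex_intro _ _ (near_pair_piece u); exists w; exact: piece_sub wP.
Qed.

End pieces.

(** In normal form, bounds on the cross-ratios bound the affine coordinates from
    above and away from 0; then they bound the mutual distances from below.
    Scaling by a positive real brings the constant to modulus 1. *)
Lemma thick_cover j l m N w : uniq [:: j; l; m] -> 1 <= N ->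
  ~ (proj @` (@regular R r `&` above N)) w -> (proj @` thick j N) w.
Proof.
move=> u N1 nw; have [a ra aw] := proj_surj w.
have aN i1 i2 i3 i4 : uniq [:: i1; i2; i3; i4] -> cross a i1 i2 i3 i4 <= N.
  move=> u'; rewrite leNgt; apply/negP => h; apply: nw; exists a => //; split => //.
  by exists i1, i2, i3, i4.
have [b [ab rb nb bE]] := exists_normalized ksum u ra.
have b1 : 0 < nrm b.1 by rewrite nrm_gt0; case: rb.
pose b' := rescale (nrm b.1)^-1 b.
have pb' : proj b' = w.
  have c0 : 0 < (nrm b.1)^-1 by rewrite invr_gt0.
  exact: (etrans (proj_rescale rb c0) (etrans (esym (proj_isomorphic ra rb ab)) aw)).
exists b' => //.
have N0 : 0 < N by exact: lt_le_trans N1.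
have cN i1 i2 i3 i4 : uniq [:: i1; i2; i3; i4] -> cross b i1 i2 i3 i4 <= N.
  by move=> u'; rewrite bE aN.
have [bj bl bm bt] := nb.
move: u; rewrite /= !inE negb_or => /and3P[/andP[jl jm] lm _].
have n1 : nrm 1 = 1 by exact: Normc.normc1.
have n0 : nrm 0 = 0 by exact: Normc.normc0.
have wj t : t != j -> nrm (wedge (sing b t) (sing b j)) = 1.
  by move=> tj; rewrite (normalized_sing nb tj) bj wedge_vec mulr0 mulr1 sub0r nrmN n1.
have wj' t : t != j -> nrm (wedge (sing b j) (sing b t)) = 1.
  by move=> tj; rewrite (normalized_sing nb tj) bj wedge_vec mulr1 mul0r subr0 n1.
have wl t : t != j -> nrm (wedge (sing b t) (sing b l)) = nrm (coord b t).
  by move=> tj; rewrite (normalized_sing nb tj) bl wedge_vec mulr1 mulr0 subr0.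
have [cj cl cm] : [/\ coord b j = 1, coord b l = 0 & coord b m = 1].
  by rewrite /coord bj bl bm !vec0.
have Ninv : N^-1 <= 1 by rewrite invf_le1.
(* The cross-ratios of t with j, l, m bound its coordinate on both sides. *)
have upper t : nrm (coord b t) <= N.
  have [->|tj] := eqVneq t j; first by rewrite cj n1.
  have [->|tl] := eqVneq t l; first by rewrite cl n0 ltW.
  have [->|tm] := eqVneq t m; first by rewrite cm n1.
  have mj : m != j by rewrite eq_sym.
  have ml : m != l by rewrite eq_sym.
  have := cN t l m j; rewrite /= !inE !negb_or tl tm tj lm [l == j]eq_sym jl mj => /(_ isT).
  by rewrite /cross !Normc.normcM !wj// !wl// cm n1 !mulr1 divr1.
have lower t : t != j -> t != l -> N^-1 <= nrm (coord b t).
  move=> tj tl; have [->|tm] := eqVneq t m; first by rewrite cm n1.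
  have u' : uniq [:: t; j; m; l].
    by rewrite /= !inE !negb_or tj tm tl jm jl [m == l]eq_sym lm.
  have := cN _ _ _ _ u'; rewrite (normalized_cross nb u') => h.
  have [c0|c0] := eqVneq (nrm (coord b t)) 0.
    have [_ _ /(_ t l tl)] := rb.
    by rewrite -nrm_eq0 wl// c0 eqxx.
  have cp : 0 < nrm (coord b t) by rewrite lt_neqAle eq_sym c0 nrm_ge0.
  by rewrite -[leRHS]invrK lef_pV2// posrE invr_gt0.
have NN : N ^- 2 <= N^-1.
  by rewrite expr2 invfM ler_piMr ?invr_ge0// ltW.
split.
  exists (b'.1, \row_t coord b t).
    split => /=; last by move=> t; rewrite mxE.
    have -> : nrm ((nrm b.1)^-1%:C%C * b.1) = 1.
      have nC (x : R) : nrm x%:C%C = `|x| by rewrite /= expr0n addr0 sqrtr_sqr.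
      by rewrite Normc.normcM nC ger0_norm ?invr_ge0 ?nrm_ge0// mulVf// gt_eqF.
    by rewrite lexx.
  rewrite /frame /=; congr pair; apply/matrixP => t c; rewrite !mxE.
  have [->|tj] := eqVneq t j.
    have := congr1 (fun v : 'rV[C]_2 => v ord0 c) bj; rewrite !mxE => ->.
    by case: ifP.
  case: ifPn => [/eqP->|c0]; first by rewrite /coord mxE.
  have -> : c = ord_max by apply: val_inj; case: c c0 => -[|[|]].
  by have := bt t tj; rewrite mxE.
move=> [t t'] /= tt.
change (N ^- 2 <= nrm (wedge (sing b t) (sing b t'))).
have [ej|tj] := eqVneq t j.
  by rewrite ej wj' ?(le_trans NN)//; rewrite eq_sym -ej.
have [ej|t'j] := eqVneq t' j; first by rewrite ej wj// (le_trans NN).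
have [el|t'l] := eqVneq t' l.
  by rewrite el wl// (le_trans NN)// lower// -el.
have [el|tl] := eqVneq t l.
  by rewrite el -nrmN -wedgeC wl// (le_trans NN)// lower.
(* The distance from t to t' appears in the cross-ratio of t, l, j, t', which is
   |coord b t| divided by it. *)
have u' : uniq [:: t; l; j; t'].
  by rewrite /= !inE !negb_or tl tj tt [l == j]eq_sym jl [l == t']eq_sym t'l [j == t']eq_sym t'j.
have w0' : 0 < nrm (wedge (sing b t) (sing b t')) by rewrite nrm_gt0; case: rb => _ _; apply.
have := cN _ _ _ _ u'; rewrite /cross !Normc.normcM wl// wj'// wj'; last by rewrite eq_sym.
rewrite !mulr1 ler_pdivrMr// => h.
rewrite expr2 invfM ler_pdivrMl//.
by rewrite (le_trans (lower t tj tl)).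
Qed.

Lemma unique_end_stratum1 : exists! e : {K : set (stratum1 R k) | compact K} -> set (stratum1 R k),
  is_end e.
Proof.
pose U (n : nat) := proj @` (@regular R r `&` below n.+1%:R).
pose E (n : nat) := proj @` (@regular R r `&` above n.+1%:R).
have N0 (n : nat) : 0 < n.+1%:R :> R by [].
have belowS := @proj_invariant (below _) (@below_isomorphic _) (fun c a => iff_refl _).
have aboveS := @proj_invariant (above _) (@above_isomorphic _) (fun c a => iff_refl _).
have openE n : open (E n).
  apply: open_proj_invariant; [exact: above_isomorphic|by []|exact: above_near].
apply: (@unique_end _ U E).
- by move=> n; apply: open_proj_invariant; [exact: below_isomorphic|by []|exact: below_near].
- move=> m n mn _ [a [ra am] <-]; exists a => //; split => // i j p l u.
  by rewrite (lt_le_trans (am i j p l u))// ler_nat.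
- move=> w; have [a ra <-] := proj_surj w; have [n an] := exists_below a.
  exists n; exists a => //; split => // i j p l u.
  by rewrite (lt_le_trans (an i j p l u))// ler_nat.
- by move=> n; exact: connected_above.
- by move=> n; exact: above_nonempty.
- move=> n _ [a [ra an] <-] /aboveS[//|i [j [m [l [u h]]]]].
  by have := lt_trans h (an i j m l u); rewrite ltxx.
- move=> n; rewrite precompact_closed; last exact: open_closedC.
  have t_lt p : (p < 4)%N -> (p < r)%N by move=> p4; exact: leq_trans p4 (r_ge4 k_ge ksum).
  pose t p (p4 : (p < 4)%N) : 'I_r := Ordinal (t_lt p p4).
  have u : uniq [:: t 0%N isT; t 1%N isT; t 2%N isT] by [].
  have cT : compact (proj @` thick (t 0%N isT) n.+1%:R).
    apply: continuous_compact; last exact: compact_thick.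
    by apply: continuous_subspaceW continuous_proj; exact: thick_regular.
  apply: (subclosed_compact _ cT); first exact: open_closedC.
  by move=> w nw; apply: thick_cover u _ nw; rewrite (ler_nat R 1).
Qed.

End moduli.

Local Open Scope ring_scope.

Theorem corollary1p3 (R : realType) (r : nat) (k : 'I_r -> int)
    (hk : forall i, -1 <= k i) (hsum : \sum_(i < r) k i = -4) :
  exists! e : {K : set (stratum1 R k) | compact K} -> set (stratum1 R k),
    is_end e.
Proof.
have r4 := r_ge4 hk hsum.
pose i0 := Ordinal (leq_trans (isT : (0 < 4)%N) r4).
pose i1 := Ordinal (leq_trans (isT : (1 < 4)%N) r4).
have i01 : i0 != i1 by [].
have [a _] := regular_qdiff hk hsum (near_pair_regular (@ltr01 R) i01).
exact: (unique_end_stratum1 hk hsum (moduli hk hsum a)).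
Qed.
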